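(* Let $n\geq 2$. The conjugacy problem for Houghton's group $H_n$ is solvable; that is, there is an algorithm which, given two words over $S^{\pm 1}$ representing elements $g,h\in H_n$, decides whether or not $g$ and $h$ are conjugate in $H_n$. Moreover, there is an algorithm which, given two conjugate elements $g,h\in H_n$ (as words over $S^{\pm1}$), finds $x\in H_n$ (as a word over $S^{\pm 1}$) such that $g^x=x^{-1}gx=h$.
   Context: Let $\mathbb{N}=\{0,1,2,\ldots\}$ and $X_n=\{1,\ldots,n\}\times\mathbb{N}$. Permutations act on the right, so $x(gh)=(xg)h$. Houghton's group $H_n$ is the group of all permutations $g$ of $X_n$ for which there exist a positive integer $z$ and integers $t_1(g),\ldots,t_n(g)$ such that $(i,m)g=(i,m+t_i(g))$ for all $i\in\{1,\ldots,n\}$ and all $m\geq z$. For $n\ge 2$, $H_n$ is generated by a finite set $S$: for $2\le i\le n$ let $g_i$ be the permutation given in cycle notation by $g_i=(\ldots,(i,2),(i,1),(i,0),(1,0),(1,1),(1,2),\ldots)$, i.e. $(1,m)g_i=(1,m+1)$ for $m\ge0$, $(i,m)g_i=(i,m-1)$ for $m\geq 1$, $(i,0)g_i=(1,0)$, and $g_i$ fixes all other points; then $S=\{g_2,\ldots,g_n\}$ if $n\geq 3$, and $S=\{g_2,\tau\}$ if $n=2$, where $\tau$ is the transposition of $(1,0)$ and $(2,0)$. Solvability of the conjugacy problem does not depend on the chosen finite generating set. *)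

(* Defs.v *)
From HB Require Import structures.
From mathcomp Require Import all_boot all_order all_algebra.
From mathcomp Require Import boolp zify.

Set Implicit Arguments.
Unset Strict Implicit.
Unset Printing Implicit Defensive.

(* [recf n]: Kleene's codes for the n-ary partial recursive functions. *)
Inductive recf : nat -> Type :=
| Rzero n : recf n
| Rsucc : recf 1
| Rproj n (i : 'I_n) : recf n
| Rcomp m n (f : recf m) (g : 'I_m -> recf n) : recf n
| Rprec n (f : recf n) (g : recf n.+2) : recf n.+1
| Rmin n (f : recf n.+1) : recf n.

(* [computes f s y]: the computation of [f] on the input [s] halts with output
   [y].  Primitive recursion is on the first argument [k], whose step function
   receives [k], the previous value and the parameters; [r] is the sequence of
   successive values.  Minimisation is over the first argument and requires all
   the earlier values to be defined and nonzero. *)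
Fixpoint computes n (f : recf n) : n.-tuple nat -> nat -> Prop :=
  match f in recf n return n.-tuple nat -> nat -> Prop with
  | Rzero n => fun _ y => y = 0
  | Rsucc => fun s y => y = (thead s).+1
  | Rproj n i => fun s y => y = tnth s i
  | Rcomp m n f g => fun s y =>
      exists ys : m.-tuple nat,
        (forall i, computes (g i) s (tnth ys i)) /\ computes f ys y
  | Rprec n f g => fun s y =>
      exists r : nat -> nat,
        [/\ computes f (behead_tuple s) (r 0),
            forall k, k < thead s ->
              computes g (cons_tuple k (cons_tuple (r k) (behead_tuple s)))
                         (r k.+1)
          & y = r (thead s)]
  | Rmin n f => fun s y =>
      computes f (cons_tuple y s) 0 /\
      forall z, z < y -> exists v, computes f (cons_tuple z s) v.+1
  end.

Lemma computes_inj n (f : recf n) s y1 y2 :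
  computes f s y1 -> computes f s y2 -> y1 = y2.
Proof.
elim: f s y1 y2 => {n} [n|||m n f IHf g IHg|n f IHf g IHg|n f IHf] s y1 y2 /=.
- by move=> -> ->.
- by move=> -> ->.
- by move=> n i -> ->.
- move=> [ys1 [g1 f1]] [ys2 [g2 f2]]; apply: IHf f1 _.
  suff -> : ys1 = ys2 by [].
  by apply: eq_from_tnth => i; apply: IHg (g1 i) (g2 i).
- move=> [r1 [f1 g1 ->]] [r2 [f2 g2 ->]].
  suff H k : k <= thead s -> r1 k = r2 k by apply: H.
  elim: k => [_|k IHk lt_ks]; first exact: IHf f1 f2.
  apply: IHg (g1 k lt_ks) _; rewrite (IHk (ltnW lt_ks)); exact: g2.
- move=> [f1 m1] [f2 m2]; case: (ltngtP y1 y2) => // [lt12|lt21].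
  + by have [v fv] := m2 _ lt12; have := IHf _ _ _ f1 fv.
  + by have [v fv] := m1 _ lt21; have := IHf _ _ _ f2 fv.
Qed.

Section ConjugacyProblem.
Variables (G : groupType) (S : seq G).
Local Open Scope group_scope.

(* The letter [(i, b)] stands for the i-th element of [S] if [b] is false, and
   for its inverse if [b] is true. *)
Definition letter : Type := ('I_(size S) * bool)%type.
Definition word : Type := seq letter.

Definition letter_val (l : letter) : G :=
  let s := tnth (in_tuple S) l.1 in if l.2 then s^-1 else s.

Definition word_val (w : word) : G := \prod_(l <- w) letter_val l.

(* [CodeSeq.code] is the bijection from [seq nat] to [nat] sending the empty
   sequence to 0 and [k :: s] to 2^k (2 code(s) + 1). *)
Definition letter_code (l : letter) : nat := (l.1.*2 + l.2)%N.
Definition word_code (w : word) : nat := CodeSeq.code (map letter_code w).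

Definition conjugate (g h : G) : Prop := exists x : G, g ^ x = h.

Definition conjugacy_problem_solvable : Prop :=
  exists A : recf 2, forall u v : word,
    exists b : bool,
      computes A [tuple word_code u; word_code v] b /\
      (b <-> conjugate (word_val u) (word_val v)).

(* Nothing is required of the algorithm on non-conjugate inputs, on which it
   need not halt. *)
Definition conjugator_search_solvable : Prop :=
  exists A : recf 2, forall u v : word,
    conjugate (word_val u) (word_val v) ->
    exists w : word,
      computes A [tuple word_code u; word_code v] (word_code w) /\
      word_val u ^ word_val w = word_val v.

End ConjugacyProblem.

Record sym (T : Type) := Sym {
  sfun :> T -> T;
  sinv : T -> T;
  sfunK : cancel sfun sinv;
  sinvK : cancel sinv sfun
}.

Section Sym.
Variable T : Type.
Implicit Types g h : sym T.

Lemma symP g h : g =1 h -> g = h.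
Proof.
case: g h => [f f' fK f'K] [k k' kK k'K] /= /funext efk; subst k.
have ef' : f' = k' by apply/funext => x; rewrite -{1}(k'K x) fK.
by subst k'; congr Sym; apply: Prop_irrelevance.
Qed.

Definition sym_one : sym T := @Sym T id id (fun _ => erefl) (fun _ => erefl).
Definition sym_inv g : sym T := Sym (@sinvK _ g) (@sfunK _ g).
(* Permutations act on the right: [g * h] applies [g] first. *)
Definition sym_mul g h : sym T :=
  @Sym T (h \o g) (sinv g \o sinv h)
    (can_comp (@sfunK _ h) (@sfunK _ g)) (can_comp (@sinvK _ g) (@sinvK _ h)).

HB.instance Definition _ := gen_eqMixin (sym T).
HB.instance Definition _ := gen_choiceMixin (sym T).

Fact sym_mulA : associative sym_mul. Proof. by move=> *; apply: symP. Qed.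
Fact sym_mul1 : left_id sym_one sym_mul. Proof. by move=> *; apply: symP. Qed.
Fact sym_mul_1 : right_id sym_one sym_mul. Proof. by move=> *; apply: symP. Qed.
Fact sym_mulV : left_inverse sym_one sym_inv sym_mul.
Proof. by move=> g; apply: symP => x /=; rewrite sinvK. Qed.
Fact sym_mul_V : right_inverse sym_one sym_inv sym_mul.
Proof. by move=> g; apply: symP => x /=; rewrite sfunK. Qed.

HB.instance Definition _ :=
  isGroup.Build (sym T) sym_mulA sym_mul1 sym_mul_1 sym_mulV sym_mul_V.

Lemma symM g h x : (g * h)%g x = h (g x). Proof. by []. Qed.
Lemma sym1 x : (1%g : sym T) x = x. Proof. by []. Qed.
Lemma symV g x : (g^-1)%g x = sinv g x. Proof. by []. Qed.

End Sym.

Section Houghton.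
Variable n : nat.

(* The rays are numbered from 0 instead of 1. *)
Definition points : Type := ('I_n * nat)%type.

Definition is_houghton (g : sym points) : Prop :=
  exists (z : nat) (t : 'I_n -> int), 0 < z /\
    forall (i : 'I_n) (m : nat), z <= m ->
      (g (i, m)).1 = i /\ ((g (i, m)).2%:Z = m%:Z + t i)%R.

Definition houghton_pred : {pred sym points} := [pred g | `[< is_houghton g >]].

Lemma houghton_predP g : reflect (is_houghton g) (g \in houghton_pred).
Proof. exact: asboolP. Qed.

Lemma houghton_group_closed : group_closed houghton_pred.
Proof.
split=> [|g h /houghton_predP[z [t [z0 gE]]] /houghton_predP[y [s [y0 hE]]]].
  apply/houghton_predP; exists 1%N, (fun=> 0%R); split=> // i m _.
  by rewrite sym1 GRing.addr0.
pose T := \max_(j < n) `|t j|; pose U := \max_(j < n) `|s j|.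
have leT j : `|t j| <= T by exact: (leq_bigmax (F := fun j => absz (t j))).
have leU j : `|s j| <= U by exact: (leq_bigmax (F := fun j => absz (s j))).
have shiftE (f : sym points) i m k :
    (f (i, m)).1 = i -> ((f (i, m)).2 = k) -> f (i, m) = (i, k).
  by case: (f (i, m)) => a b /= -> ->.
apply/houghton_predP; exists (z + y + T + U), (fun i => t i - s i)%R.
split=> [|i m le_m]; first by lia.
have := leT i; have := leU i => leUi leTi.
have [|g1 g2] := gE i m; first by lia.
pose k := absz (m%:Z + t i - s i)%R.
have kE : (k%:Z = m%:Z + t i - s i)%R by rewrite /k; lia.
have [|h1 h2] := hE i k; first by lia.
have hk : h (i, k) = g (i, m).
  rewrite (shiftE g i m _ g1 erefl); apply: shiftE h1 _; lia.
by rewrite symM symV -hk sfunK /=; split=> //; rewrite kE GRing.addrA.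
Qed.

Record houghton := Houghton {
  hperm :> sym points;
  _ : hperm \in houghton_pred
}.

HB.instance Definition _ := [isSub for hperm].
HB.instance Definition _ := [Choice of houghton by <:].
HB.instance Definition _ :=
  SubChoice_isSubGroup.Build (sym points) houghton_pred houghton
    houghton_group_closed.

End Houghton.

Section Transposition.
Variables (n : nat) (a b : points n).

Definition swap_fun (x : points n) : points n :=
  if x == a then b else if x == b then a else x.

Lemma swap_funK : involutive swap_fun.
Proof.
move=> x; rewrite /swap_fun; case: (eqVneq x a) => [->|xa].
  by case: (eqVneq b a) => [->|_] //; rewrite eqxx.
by case: (eqVneq x b) => [->|xb]; rewrite ?eqxx // (negPf xa) (negPf xb).
Qed.

Definition swap_sym : sym (points n) := Sym swap_funK swap_funK.

Lemma swap_houghton : swap_sym \in @houghton_pred n.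
Proof.
apply/houghton_predP; exists (a.2 + b.2).+1, (fun=> 0%R); split=> // i m le_m.
rewrite GRing.addr0 /= /swap_fun.
by case: eqP => [E|_]; [|case: eqP => [E|_] //]; move: le_m; rewrite -E /=; lia.
Qed.

Definition transposition : houghton n := Houghton swap_houghton.

End Transposition.

Section Transfer.
Variables (n : nat) (o i : 'I_n).
Hypothesis oi : i != o.

(* The cycle (..., (i,2), (i,1), (i,0), (o,0), (o,1), (o,2), ...). *)
Definition transfer_fun (x : points n) : points n :=
  if x.1 == o then (o, x.2.+1)
  else if x.1 == i then (if x.2 is m.+1 then (i, m) else (o, 0%N))
  else x.

Definition transfer_inv (x : points n) : points n :=
  if x.1 == o then (if x.2 is m.+1 then (o, m) else (i, 0%N))
  else if x.1 == i then (i, x.2.+1)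
  else x.

Lemma transfer_funK : cancel transfer_fun transfer_inv.
Proof.
rewrite /transfer_fun /transfer_inv => -[j m] /=.
case: (eqVneq j o) => [->|jo] /=; first by rewrite eqxx.
case: (eqVneq j i) => [->|ji] /=; last by rewrite (negPf jo) (negPf ji).
by case: m => [|m] /=; rewrite ?eqxx // (negPf oi).
Qed.

Lemma transfer_invK : cancel transfer_inv transfer_fun.
Proof.
rewrite /transfer_fun /transfer_inv => -[j m] /=.
case: (eqVneq j o) => [->|jo] /=.
  by case: m => [|m] /=; rewrite ?eqxx // (negPf oi).
case: (eqVneq j i) => [->|ji] /=; last by rewrite (negPf jo) (negPf ji).
by rewrite (negPf oi) eqxx.
Qed.

Definition transfer_sym : sym (points n) := Sym transfer_funK transfer_invK.

Lemma transfer_houghton : transfer_sym \in @houghton_pred n.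
Proof.
apply/houghton_predP; exists 1%N.
exists (fun j => if j == o then 1 else if j == i then -1 else 0)%R.
split=> // j [//|m] _ /=; rewrite /transfer_fun /=.
by case: (eqVneq j o) => [->|_]; [|case: (eqVneq j i) => [->|_]]; split=> //=; lia.
Qed.

Definition transfer : houghton n := Houghton transfer_houghton.

End Transfer.

Section Generators.
Variables (n : nat) (hn : 2 <= n).

Definition ray1 : 'I_n := Ordinal (ltnW hn).
Definition ray2 : 'I_n := Ordinal hn.

Definition houghton_gens : seq (houghton n) :=
  [seq transfer (valP i) | i <- enum {: {i : 'I_n | i != ray1}}] ++
  (if n == 2 then [:: transposition (ray1, 0) (ray2, 0)] else [::]).

End Generators.

(* Main.v *)
Require Import Defs.
From mathcomp Require Import all_boot all_algebra.
From mathcomp Require Import boolp zify.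

Set Implicit Arguments.
Unset Strict Implicit.
Unset Printing Implicit Defensive.

(** Each element of the group moves the points far out on the rays by constant
    shifts, so it is controlled by one number K bounding both its shifts and
    the height above which it is a translation ([tame]); for the value of a
    word, K is at most a constant times the length of the word.

    Conjugacy is decided by trying all the words up to some length as
    conjugators.  This is an algorithm because two words can be compared by
    running them on finitely many points ([conjugator_test]); it is correct if
    conjugate elements g and h have a conjugator whose length is bounded by a
    recursive function of K ([short_conjugator]).  The conjugator search is the
    same test without a bound on the candidates.

    The bound has two halves.  The geometric half ([bounded_conjugator]) turns
    an arbitrary conjugator x into one controlled in terms of K.  An infinite
    orbit of g passes in boundedly many steps from one ray to another through
    the finite core below height K, so its positions on the rays are determined
    by the elapsed time up to a bounded error ([phase_le]).  Since x carries
    orbits of g to orbits of h and respects time, the shifts of x on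
    two rays joined by an orbit amount to nearly the same number of steps of g
    ([linked_shift]).  Composing x with a suitable power of g on each family of
    joined rays makes all these shifts small ([realign]).  On the rays where g
    has shift zero, far points are fixed by g and by h, and any matching of the
    fixed points of g with those of h will do; one such ray is enough to absorb
    the difference between the numbers of fixed points in the core
    ([transport]).

    The algebraic half ([spelled_tame]) writes a permutation controlled by K as
    a word of bounded length.  The shifts of a permutation sum to zero
    ([tame_sum0]), so they can be cancelled by generators; what remains moves
    finitely many points and is a product of transpositions, each of which is a
    conjugate of a short word ([spelled_swap]). *)

(** * Permutations that are translations far out on the rays *)

Section IntegerIterates.
Variable T : Type.
Implicit Types (g h : sym T) (c : int) (p : T).

Definition zact g c p : T :=
  match c with Posz k => iter k g p | Negz k => iter k.+1 (sinv g) p end.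

Lemma zactS g c p : zact g (c + 1)%R p = g (zact g c p).
Proof.
case: c => [k|[|k]].
- by rewrite (_ : (Posz k + 1 = Posz k.+1)%R) //; lia.
- by rewrite (_ : (Negz 0 + 1 = 0)%R) //= sinvK.
- by rewrite (_ : (Negz k.+1 + 1 = Negz k)%R) /= ?sinvK //; lia.
Qed.

Lemma zactP g c p : zact g (c - 1)%R p = sinv g (zact g c p).
Proof.
have {2}-> : (c = (c - 1) + 1)%R by lia.
by rewrite zactS sfunK.
Qed.

Lemma zactD g a b p : zact g (a + b)%R p = zact g a (zact g b p).
Proof.
elim/int_rect: a => [|k IHk|k IHk]; first by rewrite GRing.add0r.
- have -> : (k.+1%:Z + b = (k%:Z + b) + 1)%R by lia.
  by rewrite zactS IHk -zactS; congr (zact _ _ _); lia.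
- have -> : (- k.+1%:Z + b = (- k%:Z + b) - 1)%R by lia.
  by rewrite zactP IHk -zactP; congr (zact _ _ _); lia.
Qed.

Lemma zactK g c p : zact g (- c)%R (zact g c p) = p.
Proof. by rewrite -zactD GRing.addNr. Qed.

Lemma zactNK g c p : zact g c (zact g (- c)%R p) = p.
Proof. by rewrite -zactD GRing.addrN. Qed.

Lemma zact_inj g c : injective (zact g c).
Proof. by move=> p q /(congr1 (zact g (- c)%R)); rewrite !zactK. Qed.

Lemma zact_inv g c p : zact g^-1%g c p = zact g (- c)%R p.
Proof.
elim/int_rect: c => [|k IHk|k IHk]; first by [].
- have -> : (k.+1%:Z = k%:Z + 1)%R by lia.
  have -> : (- (k%:Z + 1) = - k%:Z - 1)%R by lia.
  by rewrite zactP -IHk zactS.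
- have -> : (- k.+1%:Z = - k%:Z - 1)%R by lia.
  have -> : (- (- k%:Z - 1) = - - k%:Z + 1)%R by lia.
  by rewrite zactS -IHk zactP.
Qed.

Lemma zact_equiv g h (x : T -> T) c p :
  (forall q, x (g q) = h (x q)) -> x (zact g c p) = zact h c (x p).
Proof.
move=> xgh; elim/int_rect: c => [|k IHk|k IHk] //.
- have -> : (k.+1%:Z = k%:Z + 1)%R by lia.
  by rewrite !zactS xgh IHk.
- have -> : (- k.+1%:Z = - k%:Z - 1)%R by lia.
  by rewrite !zactP -IHk -{2}(sinvK g (zact g (- k%:Z)%R p)) xgh sfunK.
Qed.

End IntegerIterates.

Section Tame.
Variable n : nat.
Implicit Types (K m : nat) (t s : 'I_n -> int) (g h : sym (points n)).
Implicit Types (p q : points n).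

(** Asking for the inverse as well makes the notion symmetric under inversion
    with the same K, so that statements about the future of an orbit give those
    about its past. *)
Definition tame K t g : Prop :=
  (forall i, absz (t i) <= K) /\
  forall i m, K <= m -> g (i, m) = (i, absz (m%:Z + t i)%R) /\
                        sinv g (i, m) = (i, absz (m%:Z - t i)%R).

Lemma tameV K t g : tame K t g -> tame K (fun i => - t i)%R g^-1%g.
Proof.
move=> [tK gE]; split=> [i|i m Km]; first by have := tK i; lia.
have [gi gVi] := gE i m Km; rewrite symV gVi -[sinv _ _]/(g (i, m)) gi.
by split=> //; congr pair; lia.
Qed.

Lemma tameW K L t g : K <= L -> tame K t g -> tame L t g.
Proof.
move=> KL [tK gE]; split=> [i|i m Lm]; first exact: leq_trans (tK i) KL.
by apply: gE; lia.
Qed.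

Lemma tameM K L t s g h :
  tame K t g -> tame L s h -> tame (K + L) (fun i => t i + s i)%R (g * h)%g.
Proof.
move=> [tK gE] [sL hE]; split=> [i|i m Km].
  by have := tK i; have := sL i; lia.
have ti := tK i; have si := sL i; rewrite symM /=; split.
- have [|-> _] := gE i m; first lia.
  have [|-> _] := hE i (absz (m%:Z + t i)%R); first lia.
  by congr pair; lia.
- have [|_ ->] := hE i m; first lia.
  have [|_ ->] := gE i (absz (m%:Z - s i)%R); first lia.
  by congr pair; lia.
Qed.

Lemma tame1 K : tame K (fun=> 0%R) 1%g.
Proof. by split=> [//|i m _] /=; split; congr pair; lia. Qed.

(** Below 2K a preimage need not lie on the part of the ray that is known to be
    translated, whence the doubling. *)
Lemma tame_forward K t g :
    (forall i, absz (t i) <= K) ->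
    (forall i m, K <= m -> g (i, m) = (i, absz (m%:Z + t i)%R)) ->
  tame K.*2 t g.
Proof.
move=> tK gE; split=> [i|i m Km]; first by have := tK i; lia.
have ti := tK i; split; first by apply: gE; lia.
suff {1}-> : (i, m) = g (i, absz (m%:Z - t i)%R) by rewrite sfunK.
by rewrite gE; [congr pair|]; lia.
Qed.

Lemma houghton_tame g : g \in @houghton_pred n -> exists K t, tame K t g.
Proof.
move=> /houghton_predP[z [t [_ gE]]].
pose T := \max_(j < n) absz (t j).
have leT j : absz (t j) <= T by exact: (leq_bigmax (F := fun j => absz (t j))).
exists (z + T).*2, t; apply: tame_forward => [i|i m Km].
  by have := leT i; lia.
have [|g1 g2] := gE i m; first by lia.
by rewrite [LHS]surjective_pairing g1; congr pair; lia.
Qed.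

Lemma tame_uniq K L t s g : tame K t g -> tame L s g -> t = s.
Proof.
move=> [tK gE] [sL gE']; apply/funext => i.
have [|gi _] := gE i (K + L); first lia.
have [|gi' _] := gE' i (K + L); first lia.
by move: gi'; rewrite gi => -[]; have := tK i; have := sL i; lia.
Qed.

Definition far K p := K <= p.2.

Lemma iter_far K t g k i m :
  tame K t g -> K <= m -> (0 <= t i)%R ->
  iter k g (i, m) = (i, absz (m%:Z + k%:Z * t i)%R).
Proof.
move=> [tK gE] Km ti; elim: k => [|k IHk] /=; first by congr pair; lia.
rewrite IHk; have [|-> _] := gE i (absz (m%:Z + k%:Z * t i)%R); first nia.
by congr pair; nia.
Qed.

(** Every intermediate position lies between the two ends, hence is also at
    height at least K and is translated by the next step. *)
Lemma zact_far K t g (r : int) i m :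
  tame K t g -> K <= m -> (K%:Z <= m%:Z + r * t i)%R ->
  zact g r (i, m) = (i, absz (m%:Z + r * t i)%R).
Proof.
move=> gT.
have up (c : int) (l : nat) : K <= l -> (0 <= c * t i)%R ->
    zact g c (i, l) = (i, absz (l%:Z + c * t i)%R).
  move=> Kl; case: c => [k|k] kt; last first.
    rewrite -[Negz k]GRing.opprK -zact_inv (_ : (- Negz k)%R = k.+1) ?NegzE //.
    rewrite /zact (iter_far _ (tameV gT) Kl) /=; last by nia.
    by congr pair; lia.
  rewrite /zact; case: k kt => [|k] kt /=; first by congr pair; lia.
  by rewrite -iterS (iter_far _ gT Kl) //; nia.
move=> Km Krm; have [rt|rt] := Num.Theory.lerP 0%R (r * t i)%R; first exact: up.
apply: (@zact_inj _ g (- r)%R); rewrite zactK up; [congr pair| |]; lia.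
Qed.

(** In one of the two directions of time the ray carries the orbit upwards. *)
Lemma zact_far_up K t g i m (L : nat) :
  tame K t g -> K <= m -> t i <> 0%R ->
  exists r : int, (L%:Z <= r * t i)%R /\
    zact g r (i, m) = (i, absz (m%:Z + r * t i)%R).
Proof.
move=> gT Km ti; have tt1 : (1 <= t i * t i)%R by nia.
have LL : ((K + L)%:Z <= (K + L)%:Z * t i * t i)%R.
  by have := Num.Theory.ler_wpM2l (_ : 0 <= (K + L)%:Z)%R tt1; lia.
exists ((K + L)%:Z * t i)%R; split; first lia.
by apply: zact_far gT Km _; lia.
Qed.

(** In the other direction of time the height on the ray drops at every step,
    and no step can jump from the far part of a ray to another ray. *)
Lemma orbit_meets_core K t g i m :
  tame K t g -> t i <> 0%R -> exists c, ~~ far K (zact g c (i, m)).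
Proof.
move=> [tK gE] ti; have [k] := ubnP m; elim: k m => // k IHk m mk.
have [Km|mK] := leqP K m; last by exists 0%R; rewrite /far /= -ltnNge.
have [gi gVi] := gE i m Km; have tKi := tK i.
have [tn|tp] := Num.Theory.lerP (t i) 0%R.
- have [|c cP] := IHk (absz (m%:Z + t i)%R); first lia.
  by exists (c + 1)%R; rewrite zactD /= gi.
- have [|c cP] := IHk (absz (m%:Z - t i)%R); first lia.
  by exists (c - 1)%R; rewrite zactD /= gVi.
Qed.

Definition box (a : 'I_n -> nat) : seq (points n) :=
  [seq (i, m) | i <- enum 'I_n, m <- iota 0 (a i)].

Lemma mem_box a p : (p \in box a) = (p.2 < a p.1).
Proof.
apply/allpairsPdep/idP => [[i [m [_ + ->]]]|pa]; first by rewrite mem_iota.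
by exists p.1, p.2; rewrite mem_enum mem_iota -surjective_pairing.
Qed.

Lemma box_uniq a : uniq (box a).
Proof.
apply: allpairs_uniq_dep => [|i _|p q _ _]; rewrite ?enum_uniq ?iota_uniq //.
by case: p q => [i m] [j l] /= [-> ->].
Qed.

Lemma size_box a : size (box a) = \sum_i a i.
Proof.
rewrite size_allpairs_dep sumnE big_map big_enum /=.
by apply: eq_bigr => i _; rewrite size_iota.
Qed.

Lemma size_cube K : size (box (fun=> K)) = n * K.
Proof. by rewrite size_box sum_nat_const card_ord. Qed.

(** The height of an exit from the core is less than 2K, and the core has n K
    points, so an exit happens by time n K, at speed at most K. *)
Definition phase_bound K := K.*2 + n * K * K.

(** At its first exit from the core, the orbit lands on a ray with a positive
    drift and climbs it forever, so height minus elapsed time times drift,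
    called below the phase of p on that ray, keeps the value it has at the exit. *)
Lemma phase_le_forward K t g p (e : nat) i m :
  tame K t g -> ~~ far K p -> iter e g p = (i, m) -> K <= m ->
  absz (m%:Z - e%:Z * t i)%R <= phase_bound K.
Proof.
move=> gT pcore ge Km; have [tK gE] := gT.
have ex : exists k, far K (iter k g p) by exists e; rewrite ge.
case: (ex_minnP ex) => k0 far0 min0.
have le0 : k0 <= e by apply: min0; rewrite ge.
have pos0 : 0 < k0 by case: (k0) far0 => //= pfar; rewrite pfar in pcore.
(* A repetition before time k0 would let the orbit leave the core earlier. *)
have le_nK : k0 <= n * K.
  rewrite -size_cube -(size_iota 0 k0) -(size_map (fun k => iter k g p)).
  apply: uniq_leq_size => [|q /mapP[k]]; last first.
    rewrite mem_iota add0n /= => kk0 ->; rewrite mem_box ltnNge.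
    by apply: contraL kk0 => /min0; rewrite -leqNgt.
  rewrite map_inj_in_uniq ?iota_uniq // => a b.
  rewrite !mem_iota !add0n /=.
  wlog ab : a b / a <= b => [sym|] ak bk E.
    by have [/sym|/ltnW/sym] := leqP a b => ->.
  apply/eqP; rewrite eqn_leq ab /= leqNgt; apply/negP => lt_ab.
  have per : iter (b - a) g p = p.
    by apply: (@zact_inj _ g a); rewrite /= -iterD subnKC // E.
  have : far K (iter (k0 - (b - a)) g p).
    rewrite -{1}per -iterD subnK ?far0 //; lia.
  by move/min0; lia.
case E0 : (iter k0 g p) far0 => [j b] /= Kb.
have prev : ~~ far K (sinv g (j, b)).
  rewrite -E0 -(prednK pos0) iterS sfunK; apply/negP => /min0; lia.
have [_ gV] := gE j b Kb; rewrite gV /far /= -ltnNge in prev.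
have tKj := tK j; rewrite /far /= in Kb.
have tj : (0 <= t j)%R by lia.
have := ge; rewrite -(subnK le0) iterD E0 (iter_far _ gT Kb tj) => -[ij mE].
subst i m; rewrite /phase_bound.
have : (k0%:Z * t j <= (n * K * K)%:Z)%R by nia.
have : (0 <= k0%:Z * t j)%R by nia.
have : (0 <= (e - k0)%:Z * t j)%R by nia.
have -> : ((e - k0 + k0)%:Z * t j = (e - k0)%:Z * t j + k0%:Z * t j)%R by lia.
lia.
Qed.

Lemma phase_le K t g p (e : int) i m :
  tame K t g -> ~~ far K p -> zact g e p = (i, m) -> K <= m ->
  absz (m%:Z - e * t i)%R <= phase_bound K.
Proof.
move=> gT pcore; case: e => k /= ge Km.
  exact: phase_le_forward gT pcore ge Km.
have := phase_le_forward (tameV gT) pcore (e := k.+1) ge Km; rewrite NegzE.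
by have -> : (m%:Z - k.+1%:Z * - t i = m%:Z - - k.+1%:Z * t i)%R by lia.
Qed.

End Tame.

(** * Bounding a conjugator *)

(** Bounds the discrepancy of [power] on two rays joined by an orbit: each
    differs from the common d of [linked_shift] by at most 2 D + K, where D
    is [phase_bound]. *)
Definition link_bound n K := 4 * phase_bound n K + K.*2.
Definition realign_bound n K := K + n * link_bound n K * K.
(** The summands are the height at which a realigned map starts to translate,
    namely K plus its shift, and the largest number of fixed points in the
    core; doubling accounts for the inverse, as in [tame_forward]. *)
Definition conj_bound n K := (K + realign_bound n K + n * K).*2.

Section Realign.
Variables (n K M : nat) (t s : 'I_n -> int) (g h x : sym (points n)).
Hypotheses (gT : tame K t g) (hT : tame K t h) (xT : tame M s x).
Hypothesis xgh : forall p, x (g p) = h (x p).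
Implicit Types p q : points n.

Notation D := (phase_bound n K).

(** Let p be a core point of the orbit and d the time from x p to a core point
    of its image.  On any ray i met by the orbit, the phase of x p is that of p
    plus s i, and also that of the core point minus d t i; phases of core points
    are bounded by [phase_le]. *)
Lemma linked_shift (c : int) i j (m l : nat) :
    t i <> 0%R -> t j <> 0%R -> K <= m -> K <= l -> zact g c (i, m) = (j, l) ->
  exists d : int, absz (s i + d * t i)%R <= D.*2 /\
                  absz (s j + d * t j)%R <= D.*2.
Proof.
move=> ti tj Km Kl gc.
have [c0] := orbit_meets_core m gT ti; set p := zact g c0 (i, m) => pcore.
(* Following the orbit up the ray until x acts there by its shift. *)
have xfar l' m' e : t l' <> 0%R -> K <= m' -> zact g e p = (l', m') ->
    exists (e' : int) (m1 : nat),
    [/\ K <= m1, (K%:Z <= m1%:Z + s l')%R, zact g e' p = (l', m1) &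
        zact h e' (x p) = (l', absz (m1%:Z + s l')%R)].
  move=> tl' Km' ge; have [r [rL rE]] := zact_far_up (K + M) gT Km' tl'.
  have [sM xE] := xT; have sl := sM l'.
  exists (r + e)%R, (absz (m'%:Z + r * t l')%R).
  have gE : zact g (r + e) p = (l', absz (m'%:Z + r * t l')%R).
    by rewrite zactD ge.
  split=> //; [lia|lia|].
  rewrite -(zact_equiv _ _ xgh) gE.
  by have [|-> _] := xE l' (absz (m'%:Z + r * t l')%R); first lia.
have [d qcore] : exists d, ~~ far K (zact h d (x p)).
  have [|e' [m1 [_ Km1 _ hE]]] := @xfar i m (- c0)%R ti Km.
    by rewrite /p zactK.
  have [d dP] := orbit_meets_core (absz (m1%:Z + s i)%R) hT ti.
  by exists (d + e')%R; rewrite zactD hE.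
have shift l' m' e : t l' <> 0%R -> K <= m' -> zact g e p = (l', m') ->
    absz (s l' + d * t l')%R <= D.*2.
  move=> tl' Km' /(xfar _ _ _ tl' Km')[e' [m1 [K1 K2 ge he]]].
  have B1 := phase_le gT pcore ge K1.
  have : zact h (e' - d)%R (zact h d (x p)) = (l', absz (m1%:Z + s l')%R).
    by rewrite -zactD GRing.subrK.
  move=> /(phase_le hT qcore) B2; have {}B2 := B2 ltac:(lia).
  move: B1 B2.
  have -> : ((e' - d) * t l' = e' * t l' - d * t l')%R by lia.
  lia.
exists d; split.
  by apply: (@shift i m (- c0)%R) => //; rewrite /p zactK.
by apply: (@shift j l (c - c0)%R) => //; rewrite /p zactD zactK.
Qed.

(** Composing x with this power of g would reduce its shift on ray i modulo
    t i. *)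
Definition power i : int := (- (s i %/ t i)%Z)%R.
Notation W := (link_bound n K).

Lemma powerE i : t i <> 0%R -> absz (s i + power i * t i)%R <= K.
Proof.
have [tK _] := gT; have := tK i; rewrite /power => tKi ti.
have := divz_eq (s i) (t i); have := modz_ge0 (s i) (introN eqP ti).
have := ltz_mod (s i) (introN eqP ti).
set a := (s i %/ t i)%Z; set b := (s i %% t i)%Z => b1 b2 E.
have -> : (s i + - a * t i = b)%R by rewrite E; lia.
lia.
Qed.

Lemma linked_power (c : int) i j (m l : nat) :
    t i <> 0%R -> t j <> 0%R -> K <= m -> K <= l -> zact g c (i, m) = (j, l) ->
  absz (power i - power j)%R <= W.
Proof.
move=> ti tj Km Kl /(linked_shift ti tj Km Kl)[d [di dj]].
have near l' : t l' <> 0%R -> absz (s l' + d * t l')%R <= D.*2 ->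
    absz (power l' - d)%R <= D.*2 + K.
  move=> tl dl; have kl := powerE tl.
  have : absz ((power l' - d) * t l')%R <= D.*2 + K.
    have -> : ((power l' - d) * t l' = power l' * t l' - d * t l')%R by lia.
    lia.
  by rewrite abszM; apply: leq_trans; rewrite leq_pmulr //; lia.
by have := near _ ti di; have := near _ tj dj; rewrite /link_bound; lia.
Qed.

(** Rays joined by an orbit are close by [linked_power]; the converse may fail,
    but a power chosen per cluster of close rays is still constant on orbits,
    and a chain of fewer than n close rays only changes it by n W,
    where W is [link_bound]. *)
Definition close : rel 'I_n := fun i j => absz (power i - power j)%R <= W.
Definition cluster_power i : int := power (fingraph.root close i).

Lemma close_sym : connect_sym close.
Proof. by apply: sym_connect_sym => i j; rewrite /close; lia. Qed.

Lemma cluster_power_linked (c : int) i j (m l : nat) :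
    t i <> 0%R -> t j <> 0%R -> K <= m -> K <= l -> zact g c (i, m) = (j, l) ->
  cluster_power i = cluster_power j.
Proof.
move=> ti tj Km Kl gc; congr power; apply/eqP.
rewrite (fingraph.root_connect close_sym); apply: connect1.
exact: linked_power gc.
Qed.

Lemma cluster_powerE i : absz (power i - cluster_power i)%R <= n * W.
Proof.
rewrite /cluster_power; have /connectP[p0 pp0 ->] := connect_root close i.
case: (shortenP pp0) => p pp up _ {p0 pp0}.
have sz : size p <= n.
  by have := max_card (mem (i :: p)); rewrite (card_uniqP up) card_ord /=; lia.
apply: (@leq_trans (size p * W)); last by rewrite leq_mul2r sz orbT.
elim: p (i) pp {up sz} => [|j p IHp] i' /=; first by rewrite GRing.subrr.
move=> /andP[ij /IHp jl]; rewrite mulSn; apply: leq_trans (leq_add ij jl).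
by move: (power i') (power j) (power (last j p)) => a b c; lia.
Qed.

Notation B := (realign_bound n K).

Lemma realigned_bound i :
  t i <> 0%R -> absz (s i + cluster_power i * t i)%R <= B.
Proof.
move=> ti; have k1 := powerE ti; have k2 := cluster_powerE i.
have [tK _] := gT; have tKi := tK i.
have k3 : absz ((power i - cluster_power i) * t i)%R <= n * W * K.
  by rewrite abszM leq_mul.
have k4 : (cluster_power i * t i =
            power i * t i - (power i - cluster_power i) * t i)%R by lia.
by rewrite k4 /realign_bound; lia.
Qed.

Definition ray_of p : option 'I_n :=
  [pick i | (t i != 0%R) && `[< exists c m, K <= m /\ zact g c p = (i, m) >]].
(** Constant on the orbits of g: if the orbit enters several rays then these lie
    in the same cluster. *)
Definition power_at p : int := oapp cluster_power 0%R (ray_of p).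

Lemma power_at_orbit c p : power_at (zact g c p) = power_at p.
Proof.
congr oapp; apply: eq_pick => i /=; congr andb; apply: asbool_equiv_eq.
split=> -[d [m [Km dE]]].
  by exists (d + c)%R, m; rewrite zactD.
by exists (d - c)%R, m; rewrite -zactD GRing.subrK.
Qed.

Lemma power_at_far i m :
  t i <> 0%R -> K <= m -> power_at (i, m) = cluster_power i.
Proof.
move=> ti Km; rewrite /power_at /ray_of; case: pickP => [j|/(_ i)] /=.
  case/andP=> /eqP tj /asboolP[c [l [Kl cE]]].
  by apply/esym; exact: cluster_power_linked cE.
by move/eqP: (ti) => -> /= /asboolP[]; exists 0%R, m.
Qed.

Definition realign_fun p := x (zact g (power_at p) p).
Definition realign_inv q := zact g (- power_at (sinv x q))%R (sinv x q).

Lemma realign_funK : cancel realign_fun realign_inv.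
Proof.
by move=> p; rewrite /realign_inv /realign_fun sfunK power_at_orbit zactK.
Qed.

Lemma realign_invK : cancel realign_inv realign_fun.
Proof.
by move=> q; rewrite /realign_inv /realign_fun power_at_orbit zactNK sinvK.
Qed.

(** Because [power_at] is constant on orbits, this twist of x by powers of g is
    bijective and still conjugates g to h. *)
Definition realign : sym (points n) := Sym realign_funK realign_invK.

Lemma realign_equiv p : realign (g p) = h (realign p).
Proof.
have sg : power_at (g p) = power_at p := power_at_orbit 1%R p.
by rewrite /= /realign_fun sg -(@zact_equiv _ g g g) // xgh.
Qed.

(** The formula is clear far enough up the ray, at a height depending on x.  It
    descends to height K + B since both sides commute with g and h, which
    translate the ray in between. *)
Lemma realign_far i m : t i <> 0%R -> K + B <= m ->
  realign (i, m) = (i, absz (m%:Z + (s i + cluster_power i * t i))%R).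
Proof.
move=> ti Km; have := realigned_bound ti; set u := (s i + _)%R => uB.
pose d := (cluster_power i * t i)%R.
have [|r [rL rE]] := zact_far_up (K + M + absz d) gT _ ti (m := m).
  by lia.
rewrite /d {d} in rL.
have [sM xE] := xT; have sMi := sM i.
(* The number r of steps takes the point so high that x translates it. *)
apply: (@zact_inj _ h r); rewrite -(zact_equiv _ _ realign_equiv) rE.
rewrite (zact_far hT); [| lia | lia].
rewrite /= /realign_fun power_at_far //; last by lia.
rewrite (zact_far gT); [| lia | lia].
have [|-> _] :=
  xE i (absz ((absz (m%:Z + r * t i))%:Z + cluster_power i * t i)%R).
  by lia.
by congr pair; lia.
Qed.

End Realign.

Section FixedPoints.
Variables (n K : nat) (o : 'I_n).
Implicit Types (L : seq (points n)) (p : points n).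

(** Below, L lists the fixed points of a permutation in the core.  Followed by
    the points of ray o from height K on, it is an enumeration of type omega. *)
Definition core_list L := uniq L /\ forall p, p \in L -> ~~ far K p.

Definition rank L p := if far K p then size L + (p.2 - K) else index p L.
Definition unrank L k :=
  if k < size L then nth (o, 0) L k else (o, K + (k - size L)).

(** Matches the enumeration given by L with the one given by L', leaving the
    other rays alone; the difference of the sizes of L and L' becomes the shift
    of ray o. *)
Definition transport L L' p :=
  if far K p && (p.1 != o) then p else unrank L' (rank L p).

Lemma transport_mem L L' p :
  ~~ far K (transport L L' p) -> (far K p || (p \in L)) ->
  transport L L' p \in L'.
Proof.
rewrite /transport; case: ifP => [/andP[-> _] //|_].
rewrite /unrank; case: ifP => [lt_L' _ _|_]; first exact: mem_nth.
by rewrite /far leq_addr.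
Qed.

Lemma transport_far L L' p : far K (transport L L' p) ->
  transport L L' p = p \/ (transport L L' p).1 = o \/ transport L L' p \in L'.
Proof.
rewrite /transport; case: ifP => [_|_]; first by left.
rewrite /unrank; case: ifP => [lt_L' _|_ _]; right; last by left.
by right; exact: mem_nth.
Qed.

Lemma transportK L L' p : core_list L -> core_list L' ->
  (far K p || (p \in L)) -> transport L' L (transport L L' p) = p.
Proof.
move=> [uL cL] [uL' cL'] Lp.
have unrankK k : rank L' (unrank L' k) = k.
  rewrite /rank /unrank; have [ltk|lek] := ltnP k (size L').
    by rewrite (negPf (cL' _ (mem_nth _ ltk))) index_uniq.
  by rewrite /far leq_addr /=; lia.
rewrite {2}/transport; case: ifP => [pfar|/negbT pnear].
  by rewrite /transport pfar.
rewrite /transport unrankK.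
have -> : far K (unrank L' (rank L p)) && ((unrank L' (rank L p)).1 != o) =
    false.
  rewrite /unrank; have [ltk|_] := ltnP; last by rewrite eqxx andbF.
  by rewrite (negPf (cL' _ (mem_nth _ ltk))).
rewrite /unrank /rank; have [pfar|pcore] := boolP (far K p).
  move: pnear; rewrite pfar negbK => /eqP po; rewrite ltnNge leq_addr /=.
  by move: pfar; rewrite /far => Kp; rewrite [RHS]surjective_pairing po;
    congr pair; lia.
by move: Lp; rewrite (negPf pcore) /= => pL; rewrite index_mem pL nth_index.
Qed.

Lemma transport_ray L L' i (m : nat) : K + size L' <= m ->
  transport L L' (i, m) =
  (i, absz (m%:Z + if i == o then (size L)%:Z - (size L')%:Z else 0)%R).
Proof.
move=> Km; rewrite /transport /far /=; have -> /= : K <= m by lia.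
case: (eqVneq i o) => [->|_] /=; last by congr pair; lia.
rewrite /rank /far /= ifT; last by lia.
by rewrite /unrank ifF; [congr pair|]; lia.
Qed.

End FixedPoints.

Section BoundedConjugator.
Variable n : nat.

Lemma fixed_core_list K (g : sym (points n)) :
  core_list K [seq p <- box (fun=> K) | g p == p].
Proof.
split=> [|p]; first exact: filter_uniq (box_uniq _).
by rewrite mem_filter mem_box ltnNge => /andP[_].
Qed.

Lemma size_fixed_core_list K (g : sym (points n)) :
  size [seq p <- box (fun=> K) | g p == p] <= n * K.
Proof. by rewrite size_filter -size_cube count_size. Qed.

Lemma transport_fixed K t (g h : sym (points n)) o p :
    tame K t g -> tame K t h -> t o = 0%R -> g p = p ->
  let L f := [seq q <- box (fun=> K) | sfun f q == q] in
  h (transport K o (L g) (L h) p) = transport K o (L g) (L h) p.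
Proof.
move=> [tK gE] [_ hE] to0 gp L.
have Lh q : q \in L h -> h q = q by rewrite mem_filter => /andP[/eqP].
have fixed_far i m : K <= m -> t i = 0%R -> h (i, m) = (i, m).
  by move=> Km ti; have [-> _] := hE i m Km; rewrite ti; congr pair; lia.
case: (boolP (far K (transport K o (L g) (L h) p))) => [pfar|pcore]; last first.
  apply/Lh/transport_mem => //; rewrite mem_filter gp eqxx mem_box /far /=.
  by case: leqP.
have [E|[E|/Lh//]] := transport_far pfar; last first.
  move: pfar; rewrite [transport _ _ _ _ _]surjective_pairing E.
  by move=> /fixed_far ->.
rewrite {}E in pfar *; case: p gp pfar => i m gp Km.
apply: fixed_far => //; have [gi _] := gE i m Km; move: gi; rewrite gp => -[].
by have := tK i; rewrite /far /= in Km; lia.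
Qed.

(** After realignment only the rays with drift zero may be uncontrolled.  Their
    far points are fixed by both g and h, so the conjugator may be replaced on
    the fixed points of g by any bijection onto those of h. *)
Theorem bounded_conjugator K M t s (g h x : sym (points n)) :
    tame K t g -> tame K t h -> tame M s x -> (forall p, x (g p) = h (x p)) ->
  exists u y, tame (conj_bound n K) u y /\ forall p, y (g p) = h (y p).
Proof.
move=> gT hT xT xgh.
pose y := realign K t s g x; have ygh : forall p, y (g p) = h (y p).
  exact: realign_equiv.
pose B := realign_bound n K.
pose v i := (s i + cluster_power K t s i * t i)%R.
have vB i : t i <> 0%R -> absz (v i) <= B by exact: realigned_bound gT i.
have yE i m : t i <> 0%R -> K + B <= m -> y (i, m) = (i, absz (m%:Z + v i)%R).
  exact: realign_far gT hT xT xgh i m.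
have [/existsP[o /eqP to0]|/existsPn tN0] := boolP [exists i, t i == 0%R];
    last first.
  have ti i : t i <> 0%R by apply/eqP/tN0.
  exists v, y; split=> //; apply: tame_forward => [i|i m Km].
    by have := vB i (ti i); rewrite -/B; lia.
  by apply: yE (ti i) _; rewrite -/B in Km *; lia.
pose L (f : sym (points n)) := [seq p <- box (fun=> K) | f p == p].
have cL f : core_list K (L f) := fixed_core_list K f.
have fixL (f : sym (points n)) p : f p = p -> far K p || (p \in L f).
  by move=> fp; rewrite mem_filter mem_box /far fp eqxx /=; case: leqP.
pose phi := transport K o (L g) (L h); pose psi := transport K o (L h) (L g).
pose z p := if g p == p then phi p else y p.
pose zi p := if h p == p then psi p else sinv y p.
have zK : cancel z zi.
  move=> p; rewrite /z; case: eqP => [gp|gp]; rewrite /zi.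
    rewrite (transport_fixed gT hT to0 gp) eqxx.
    by apply: transportK => //; exact: fixL.
  by rewrite -ygh ifF ?sfunK //; apply/eqP => /(can_inj (@sfunK _ y)).
have ziK : cancel zi z.
  move=> p; rewrite /zi; case: eqP => [hp|hp]; rewrite /z.
    rewrite (transport_fixed hT gT to0 hp) eqxx.
    by apply: transportK => //; exact: fixL.
  rewrite ifF ?sinvK //; apply/eqP => /(congr1 y).
  by rewrite ygh sinvK.
have tfix i m : K <= m -> t i = 0%R -> g (i, m) = (i, m).
  move=> Km ti; have [_ gE] := gT; have [-> _] := gE i m Km.
  by rewrite ti; congr pair; lia.
have tmove i m : K <= m -> t i <> 0%R -> g (i, m) != (i, m).
  move=> Km ti; have [tK gE] := gT; have [-> _] := gE i m Km.
  by have := tK i => tKi; apply/eqP => -[]; lia.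
have sg := size_fixed_core_list K g; have sh := size_fixed_core_list K h.
pose w i : int := if t i == 0%R then
  (if i == o then (size (L g))%:Z - (size (L h))%:Z else 0)%R else v i.
exists w, (Sym zK ziK); split=> [|p]; last first.
  rewrite /= /z; have [gp|gp] := eqVneq (g p) p.
    by rewrite !gp eqxx (transport_fixed gT hT to0 gp).
  by rewrite ifF ?ygh //; apply/eqP => /(can_inj (@sfunK _ g))/eqP; apply/negP.
apply: tame_forward => [i|i m Km].
  rewrite /w; case: eqP => [ti|/vB]; last by rewrite -/B; lia.
  by case: ifP => _; rewrite /L; lia.
rewrite -/B in Km; rewrite /= /z /w; case: eqP => [gi|/eqP gi]; case: eqP => ti.
- by apply: transport_ray; rewrite /L; lia.
- by have := tmove i m ltac:(lia) ti; rewrite gi eqxx.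
- by move: gi; rewrite tfix ?eqxx //; lia.
- by apply: yE => //; lia.
Qed.

End BoundedConjugator.

(** * Words of controlled length *)

Section Words.
Variables (G : groupType) (S : seq G).
Implicit Types (x y : G) (u v : word S) (k : nat).
Local Open Scope group_scope.

Lemma word_val_cons l u : word_val (l :: u) = letter_val l * word_val u.
Proof. exact: big_cons. Qed.

Lemma word_val_cat u v : word_val (u ++ v) = word_val u * word_val v.
Proof. exact: big_cat. Qed.

(** Lengths are kept explicit because the decision algorithm must compute a
    bound on them. *)
Definition short k x := exists2 u : word S, size u <= k & word_val u = x.

Lemma shortW k l x : k <= l -> short k x -> short l x.
Proof. by move=> kl [u uk uE]; exists u => //; exact: leq_trans kl. Qed.

Lemma short1 k : short k 1.
Proof. by exists [::] => //; exact: big_nil. Qed.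

Lemma shortM k l x y : short k x -> short l y -> short (k + l)%N (x * y).
Proof.
move=> [u uk <-] [v vl <-]; exists (u ++ v); last exact: word_val_cat.
by rewrite size_cat leq_add.
Qed.

Lemma short_mem x : x \in S -> short 1 x.
Proof.
move=> xS; have ix : (index x S < size S)%N by rewrite index_mem.
exists [:: (Ordinal ix, false)] => //.
by rewrite /word_val big_seq1 /letter_val /= (tnth_nth x) /= nth_index.
Qed.

Lemma shortV k x : short k x -> short k x^-1.
Proof.
move=> [u uk <-]; exists (rev [seq (l.1, ~~ l.2) | l <- u]).
  by rewrite size_rev size_map.
rewrite /word_val; elim: u {uk} => [|[i b] u IHu] /=.
  by rewrite !big_nil invg1.
rewrite rev_cons -cats1 big_cat big_seq1 big_cons {}IHu invgM /=.
by congr (_ * _); case: b; rewrite /letter_val /= ?invgK.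
Qed.

Lemma shortJ k l x y : short k x -> short l y -> short (k + l.*2)%N (x ^ y).
Proof.
move=> xk yl; rewrite conjgE; apply: shortW (shortM (shortV yl) (shortM xk yl)).
by rewrite -addnn; lia.
Qed.

End Words.

Section Swaps.
Variable n : nat.
Implicit Types (p q : points n) (x : sym (points n)).
Local Open Scope group_scope.

Lemma swapE p q r :
  swap_sym p q r = if r == p then q else if r == q then p else r.
Proof. by []. Qed.

Lemma swapC p q : swap_sym p q = swap_sym q p.
Proof.
apply: symP => r; rewrite !swapE.
by case: (eqVneq r p) => [->|_]; case: eqVneq.
Qed.

Lemma swap_refl p : swap_sym p p = 1.
Proof. by apply: symP => r; rewrite swapE sym1; case: eqP => [->|]. Qed.

Lemma swapJ p q x : swap_sym p q ^ x = swap_sym (x p) (x q).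
Proof.
apply: symP => r; rewrite conjgE !symM symV !swapE.
have := sinvK x r; set r' := sinv x r => <-.
by rewrite !(inj_eq (can_inj (sfunK x))); do 2!case: eqP => _ //.
Qed.

Lemma swap_mul_swap p q x : x * swap_sym p q * swap_sym p q = x.
Proof. by apply: symP => r; rewrite !symM /= swap_funK. Qed.

End Swaps.

Section Generation.
Variables (n : nat) (hn : 2 <= n).
Implicit Types (p q : points n) (x y : sym (points n)) (k : nat) (i j : 'I_n).

Notation o := (ray1 hn).
Notation slide := transfer_sym.

(** The same for bare permutations, which are easier to compare pointwise than
    elements of the subgroup. *)
Definition spelled k x :=
  exists2 y : houghton n, short (houghton_gens hn) k y & hperm y = x.

Lemma spelledW k l x : k <= l -> spelled k x -> spelled l x.
Proof. by move=> kl [y yk yx]; exists y => //; exact: shortW yk. Qed.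

Lemma spelled1 k : spelled k 1%g.
Proof. by exists 1%g => //; exact: short1. Qed.

Lemma spelledM k l x y :
  spelled k x -> spelled l y -> spelled (k + l) (x * y)%g.
Proof.
by move=> [u uk <-] [v vl <-]; exists (u * v)%g => //; exact: shortM.
Qed.

Lemma spelledV k x : spelled k x -> spelled k x^-1%g.
Proof. by move=> [u uk <-]; exists u^-1%g => //; exact: shortV. Qed.

Lemma spelledJ k l x y :
  spelled k x -> spelled l y -> spelled (k + l.*2) (x ^ y)%g.
Proof.
by move=> [u uk <-] [v vl <-]; exists (u ^ v)%g => //; exact: shortJ.
Qed.

Lemma spelledX k x m : spelled k x -> spelled (m * k) (x ^+ m)%g.
Proof.
move=> xk; elim: m => [|m IHm]; first exact: spelled1.
by rewrite expgS mulSn; apply: spelledM.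
Qed.

Lemma spelled_slide i (oi : i != o) : spelled 1 (slide oi).
Proof.
exists (transfer oi) => //; apply: short_mem; rewrite mem_cat; apply/orP; left.
apply/mapP; exists (Sub i oi); first by rewrite mem_enum.
by congr transfer; apply: Prop_irrelevance.
Qed.

Lemma slide_origin i (oi : i != o) m : slide oi (o, m) = (o, m.+1).
Proof. by rewrite /= /transfer_fun eqxx. Qed.

Lemma slide_base i (oi : i != o) : slide oi (i, 0) = (o, 0).
Proof. by rewrite /= /transfer_fun /= (negPf oi) eqxx. Qed.

Lemma slide_down i (oi : i != o) m : slide oi (i, m.+1) = (i, m).
Proof. by rewrite /= /transfer_fun /= (negPf oi) eqxx. Qed.

Lemma slide_tame i (oi : i != o) :
  tame 1 (fun j => if j == o then 1 else if j == i then -1 else 0)%R (slide oi).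
Proof.
split=> [j|j [//|m] _]; first by case: ifP => // _; case: ifP.
rewrite /= /transfer_fun /transfer_inv /=.
by case: (eqVneq j o) => [->|jo]; [|case: (eqVneq j i) => [->|ji]];
  split; congr pair; lia.
Qed.

(** If there is a third ray j, composing the slide along one of i and j with the
    inverse of the other in the two possible orders gives two shifts of the line
    formed by the rays i and j; one passes through (o, 0) and the other skips
    it, and their quotient is the swap.  With two rays the swap is a
    generator. *)
Lemma spelled_swap_base i : i != o -> spelled 4 (swap_sym (o, 0) (i, 0)).
Proof.
move=> oi; case: (eqVneq n 2) => [n2|n_neq2].
  have -> : i = ray2 hn.
    by have := ltn_ord i; apply: contraTeq; move: oi; rewrite -!val_eqE /=; lia.
  apply: (@spelledW 1) => //; exists (transposition (o, 0) (ray2 hn, 0)) => //.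
  by apply: short_mem; rewrite mem_cat (introT eqP n2) mem_seq1 eqxx orbT.
have [j jo ji] : exists2 j, j != o & j != i.
  have n3 : 2 < n by lia.
  case: (eqVneq i (ray2 hn)) => [->|i1]; last first.
    by exists (ray2 hn); rewrite // eq_sym.
  by exists (Ordinal n3).
have -> : swap_sym (o, 0) (i, 0) =
    (slide oi * (slide jo)^-1 * (slide oi)^-1 * slide jo)%g.
  apply: symP => -[l m]; rewrite !symM !symV swapE /= /transfer_fun.
  rewrite /transfer_inv !xpair_eqE /=.
  have ij : i != j by rewrite eq_sym.
  have [oi' oj'] : o != i /\ o != j by rewrite ![o == _]eq_sym.
  pose E := (negPf oi, negPf jo, negPf ij, negPf ji, negPf oi', negPf oj',
             eqxx).
  case: (eqVneq l o) => [->|lo] /=.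
    by case: m => [|m]; do 5!rewrite ?E /=.
  case: (eqVneq l i) => [->|li] /=.
    by case: m => [|m]; do 5!rewrite ?E /=.
  case: (eqVneq l j) => [->|lj] /=; first by do 5!rewrite ?E /=.
  by do 5!rewrite ?(negPf lo, negPf li, negPf lj) /=.
apply: (@spelledW (1 + 1 + 1 + 1)) => //.
apply: spelledM; last exact: spelled_slide.
apply: spelledM; last exact/spelledV/spelled_slide.
by apply: spelledM; [|apply: spelledV]; exact: spelled_slide.
Qed.

Lemma ray2_neq : ray2 hn != o. Proof. by []. Qed.

Notation up := (slide ray2_neq).

Lemma up_pow a m : (up ^+ a)%g (o, m) = (o, m + a).
Proof.
elim: a => [|a IHa]; first by rewrite addn0.
by rewrite expgSr symM IHa slide_origin addnS.
Qed.

Lemma spelled_swap_next a : spelled (6 + a.*2) (swap_sym (o, a) (o, a.+1)).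
Proof.
have base : spelled 6 (swap_sym (o, 0) (o, 1)).
  have := spelledJ (spelled_swap_base ray2_neq) (spelled_slide ray2_neq).
  rewrite swapC.
  by rewrite swapJ slide_origin slide_base.
have := spelledJ base (spelledX a (spelled_slide ray2_neq)).
by rewrite swapJ !up_pow !addnE muln1.
Qed.

(** Conjugating by the swap of two neighbours moves the upper end one step
    up. *)
Lemma spelled_swap_gap P d a : a + d <= P ->
  spelled (d.*2.+1 * (6 + P.*2)) (swap_sym (o, a) (o, a + d.+1)).
Proof.
elim: d => [|d IHd] adP.
  by rewrite addn1; apply: spelledW (spelled_swap_next a); lia.
have {}IHd := IHd ltac:(lia).
have := spelledJ IHd (spelled_swap_next (a + d.+1)); rewrite swapJ !swapE.
rewrite !xpair_eqE !eqxx /= -addnS.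
have -> /= : (a == a + d.+1) = false by lia.
have -> /= : (a == a + d.+2) = false by lia.
by apply: spelledW; lia.
Qed.

Lemma spelled_swap_ray P a b : a <= P -> b <= P ->
  spelled (P.*2 * (6 + P.*2)) (swap_sym (o, a) (o, b)).
Proof.
wlog ab : a b / a <= b => [sym aP bP|aP bP].
  by have [/sym|/ltnW/sym] := leqP a b; [|rewrite swapC]; apply.
case: (eqVneq a b) => [->|a_neq_b]; first by rewrite swap_refl; exact: spelled1.
have -> : b = a + (b - a).-1.+1 by lia.
apply: spelledW (@spelled_swap_gap P (b - a).-1 a _); last by lia.
by rewrite leq_mul2r; apply/orP; right; lia.
Qed.

(** A power of the slide along its ray pulls p onto ray o, keeps that ray
    invariant and raises no point by more than one per step. *)
Lemma spelled_to_ray p : exists z, [/\ spelled p.2.+1 z, (z p).1 = o,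
  forall q, q.1 = o -> (z q).1 = o & forall q, (z q).2 <= q.2 + p.2.+1].
Proof.
case: p => i m /=; case: (eqVneq i o) => [->|oi].
  by exists 1%g; split=> // [|q]; [exact: spelled1|rewrite sym1 leq_addr].
have step q : (slide oi q).2 <= q.2.+1.
  case: q => j l; rewrite /= /transfer_fun /=.
  by case: eqP => _ /=; [lia|case: eqP => _ /=; [case: l => [|l] /=|]; lia].
exists (slide oi ^+ m.+1)%g; split=> [|||q].
- by rewrite -[X in spelled X]muln1; exact/spelledX/spelled_slide.
- by elim: m => [|m IHm]; rewrite ?expg1 ?slide_base // expgS symM slide_down.
- elim: m.+1 => [//|k IHk] q qo; rewrite expgSr symM.
  by rewrite [X in slide oi X]surjective_pairing (IHk _ qo) slide_origin.
- elim: m.+1 => [|k IHk]; first by rewrite addn0.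
  by rewrite expgSr symM; apply: leq_trans (step _) _; rewrite addnS ltnS.
Qed.

(** Two applications of [spelled_to_ray] move any two points below height M to
    ray o, by a word of length at most 4 M and below height 5 M. *)
Definition swap_length M :=
  (5 * M).*2 * (6 + (5 * M).*2) + (4 * M).*2.

(** Bring both points to ray o, one after the other, swap them there and go
    back. *)
Lemma spelled_swap M p q : p.2 < M -> q.2 < M ->
  spelled (swap_length M) (swap_sym p q).
Proof.
move=> pM qM; have [z1 [z1s z1p z1o z1b]] := spelled_to_ray p.
have [z2 [z2s z2q z2o z2b]] := spelled_to_ray (z1 q).
have z1pb := z1b p; have z1qb := z1b q.
have z2pb := z2b (z1 p); have z2qb := z2b (z1 q).
set z := (z1 * z2)%g.
have zs : spelled (4 * M) z.
  by apply: spelledW (spelledM z1s z2s); lia.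
have -> : swap_sym p q = (swap_sym (z p) (z q) ^ z^-1)%g.
  by rewrite -swapJ conjgK.
have zp : z p = (o, (z p).2).
  by rewrite [LHS]surjective_pairing symM z2o.
have zq : z q = (o, (z q).2) by rewrite [LHS]surjective_pairing symM z2q.
apply: spelledJ (spelledV zs); rewrite zp zq.
by apply: spelled_swap_ray; rewrite symM; lia.
Qed.

(** Sorting: multiplying by the swap of p and x p fixes p without moving any
    point fixed before. *)
Lemma spelled_finitary M x (l : seq (points n)) :
    (forall p, p \in l -> p.2 < M) -> (forall p, p \notin l -> x p = p) ->
  spelled (size l * swap_length M) x.
Proof.
elim: l x => [|p l IHl] x lM xl.
  have -> : x = 1%g by apply: symP => p; rewrite xl.
  exact: spelled1.
have xpM : (x p).2 < M.
  have [/lM//|/xl] := boolP (x p \in p :: l).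
  by move=> /(can_inj (sfunK x)) ->; apply: lM; rewrite mem_head.
rewrite -(swap_mul_swap (x p) p x) /= mulSn addnC; apply: spelledM; last first.
  by apply: spelled_swap => //; apply: lM; rewrite mem_head.
apply: IHl => [q ql|q ql]; first by apply: lM; rewrite inE ql orbT.
rewrite symM swapE; case: (eqVneq q p) => [->|qp]; first by rewrite eqxx.
have -> : x q = q by apply: xl; rewrite inE negb_or qp.
rewrite (negPf qp); case: eqP => // qxp.
have : x q = x p by rewrite xl ?inE ?negb_or ?qp.
by move=> /(can_inj (sfunK x)) qp'; rewrite qp' eqxx in qp.
Qed.

(** The cube of side M = 2K is mapped bijectively onto the box whose side along
    ray i is M + t i; compare cardinals. *)
Lemma tame_sum0 K t x : tame K t x -> (\sum_i t i = 0)%R.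
Proof.
move=> [tK xE]; pose M := K.*2.
pose b i := absz (M%:Z + t i)%R.
have perm : perm_eq (map x (box (fun=> M))) (box b).
  apply: uniq_perm => [||q].
  - by rewrite map_inj_uniq ?box_uniq //; exact: can_inj (sfunK x).
  - exact: box_uniq.
  - rewrite -{1}(sinvK x q) mem_map; last exact: can_inj (sfunK x).
    rewrite !mem_box; case: q => i m /=; rewrite /b; have ti := tK i.
    have [bm|mb] := leqP (absz (M%:Z + t i)%R) m.
      have [_ ->] := xE i m ltac:(lia); rewrite /=; lia.
    rewrite ltnNge; apply/negP => Mm.
    move E : (sinv x (i, m)) Mm => [j l] /= Ml.
    have := sinvK x (i, m); rewrite E.
    by have [-> _] := xE j l ltac:(lia); case=> ji; subst j; lia.
have := perm_size perm; rewrite size_map !size_box => E.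
have : (\sum_(i < n) M%:Z = \sum_(i < n) (M%:Z + t i))%R.
  rewrite -!(big_morph Posz PoszD erefl) E (big_morph Posz PoszD erefl).
  by apply: eq_bigr => i _; have := tK i; rewrite /b; lia.
by rewrite big_split /= -{1}[LHS]GRing.addr0 => /GRing.addrI.
Qed.

(** At most d slides to cancel the drifts, each raising the bound K by one, and
    then one swap for every point of the remaining core. *)
Definition spelling_length K d := d + n * (K + d) * swap_length (K + d).

(** Multiplying by a slide or its inverse decreases the drift of one ray other
    than o in absolute value.  When all of these vanish, so does the drift of
    ray o, by [tame_sum0]. *)
Lemma spelled_tame_drift d K t x :
    tame K t x -> \sum_(i | i != o) absz (t i) <= d ->
  spelled (spelling_length K d) x.
Proof.
elim: d K t x => [|d IHd] K t x xT td.
  have t0 : forall i, t i = 0%R.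
    have t0' i : i != o -> t i = 0%R.
      move=> io; move: td; rewrite (bigD1 i) //=; lia.
    move=> i; case: (eqVneq i o) => [->|/t0'//].
    by have := tame_sum0 xT; rewrite (bigD1 o) //= big1 ?GRing.addr0.
  have [_ xE] := xT.
  have -> : spelling_length K 0 =
      size (box (fun _ : 'I_n => K)) * swap_length K.
    by rewrite size_cube /spelling_length addn0.
  apply: spelled_finitary => [p|[i m]]; first by rewrite mem_box.
  rewrite mem_box /= -leqNgt => Km; have [-> _] := xE i m Km.
  by rewrite t0; congr pair; lia.
have [/existsP[i /andP[io ti]]|/existsPn t0] :=
    boolP [exists i, (i != o) && (t i != 0%R)]; last first.
  apply: spelledW (IHd K t x xT _).
    rewrite /spelling_length; apply: leq_add => //; rewrite leq_mul ?leq_mul //.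
      by lia.
    by rewrite /swap_length; nia.
  rewrite big1 // => i io; have := t0 i; rewrite io /= negbK => /eqP -> //.
have len : 1 + spelling_length K.+1 d = spelling_length K d.+1.
  by rewrite /spelling_length [K.+1 + d]addSnnS addnA.
have [e [y [ys yT ye]]] : exists (e : int) y, [/\ spelled 1 y,
    tame 1 (fun j => if j == o then - e else if j == i then e else 0)%R y &
    absz (t i + e)%R < absz (t i)].
  have [tn|tp] := Num.Theory.lerP (t i) 0%R.
    exists 1%R, (slide io)^-1%g; split; first exact/spelledV/spelled_slide.
      have := tameV (slide_tame io); congr tame; apply/funext => j.
      by case: ifP => // _; case: ifP.
    by move/eqP: ti; lia.
  exists (-1)%R, (slide io); split; first exact: spelled_slide.
    exact: slide_tame.
  by move/eqP: ti; lia.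
rewrite -len addnC -(mulgK y x); apply: spelledM (spelledV ys).
have := tameM xT yT; rewrite addn1 => /IHd; apply.
rewrite (bigD1 i) //= (negPf io) eqxx.
move: td; rewrite (bigD1 i) //=; set A := (X in _ + X <= _ -> _).
set A' := (X in _ -> _ + X <= _); suff -> : A' = A by lia.
apply: eq_bigr => j /andP[jo ji].
by rewrite (negPf jo) (negPf ji) GRing.addr0.
Qed.

Theorem spelled_tame K t x :
  tame K t x -> spelled (spelling_length K (n * K)) x.
Proof.
move=> xT; apply: (spelled_tame_drift xT); have [tK _] := xT.
have -> : n * K = \sum_(i < n) K by rewrite sum_nat_const card_ord.
rewrite [X in _ <= X](bigID (fun i => i != o)) /=.
by apply: leq_trans (leq_addr _ _); apply: leq_sum => i _; exact: tK.
Qed.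

End Generation.

(** * Recursive functions *)

Section RecursiveFunctions.
Implicit Types (n m k : nat) (f g a b : seq nat -> nat) (s : seq nat).

(** Total functions are given on sequences, so that a variable bound by an
    iteration, a quantifier or a minimisation is pushed in front of the
    parameters; only sequences of size n matter. *)
Definition recursive n f := exists A : recf n,
  forall s : n.-tuple nat, computes A s (f s).

Lemma recursive_ext n f g :
  (forall s, size s = n -> f s = g s) -> recursive n f -> recursive n g.
Proof. by move=> fg [A AP]; exists A => s; rewrite -fg ?size_tuple. Qed.

Lemma recursive_nth n k : recursive n (fun s => nth 0 s k).
Proof.
have [kn|nk] := ltnP k n; last first.
  by exists (Rzero n) => s /=; rewrite nth_default ?size_tuple.
by exists (Rproj (Ordinal kn)) => s /=; rewrite (tnth_nth 0).
Qed.

Lemma recursive_mkseq n m f (g : nat -> seq nat -> nat) :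
    recursive m f -> (forall i, recursive n (g i)) ->
  recursive n (fun s => f (mkseq (g^~ s) m)).
Proof.
move=> [A AP] /choice[B BP]; exists (Rcomp A (fun i : 'I_m => B i)) => s /=.
exists (mktuple (fun i : 'I_m => g i s)); split=> [i|].
  by rewrite tnth_mktuple.
suff -> : mkseq (g^~ s) m = mktuple (fun i : 'I_m => g i s) by exact: AP.
by rewrite /= /mkseq -val_ord_enum -map_comp enumT unlock.
Qed.

Lemma recursive_app1 (F : nat -> nat) n a :
  recursive 1 (fun s => F (nth 0 s 0)) -> recursive n a ->
  recursive n (fun s => F (a s)).
Proof.
by move=> FP aP; exact: (recursive_mkseq (g := fun=> a) FP (fun=> aP)).
Qed.

Lemma recursive_app2 (F : nat -> nat -> nat) n a b :
  recursive 2 (fun s => F (nth 0 s 0) (nth 0 s 1)) ->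
  recursive n a -> recursive n b -> recursive n (fun s => F (a s) (b s)).
Proof.
move=> FP aP bP; pose g i := if i is 0 then a else b.
by apply: (recursive_mkseq (g := g) FP); case.
Qed.

Lemma recursive_succ n a : recursive n a -> recursive n (fun s => (a s).+1).
Proof.
apply: (@recursive_app1 succn); exists Rsucc => s /=.
by rewrite (tuple_eta s).
Qed.

Lemma recursive_const n c : recursive n (fun=> c).
Proof. by elim: c => [|c /recursive_succ//]; exists (Rzero n). Qed.

Lemma recursive_rec n a (k : seq nat -> nat) f :
    recursive n a -> recursive n k -> recursive n.+2 f ->
  recursive n (fun s => nat_rect (fun=> nat) (a s)
                          (fun i r => f (i :: r :: s)) (k s)).
Proof.
move=> [A AP] kP [F FP].
pose h t := nat_rect (fun=> nat) (a (behead t))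
  (fun i r => f (i :: r :: behead t)) (head 0 t).
have hP : recursive n.+1 h.
  exists (Rprec A F) => t /=.
  exists (nat_rect (fun=> nat) (a (behead t))
                   (fun i r => f (i :: r :: behead t))).
  split=> [|i _|]; first exact: (AP (behead_tuple t)).
    exact: (FP (cons_tuple i (cons_tuple _ (behead_tuple t)))).
  by rewrite /h (tuple_eta t).
pose g i := if i is j.+1 then (fun s => nth 0 s j) else k.
apply: (recursive_ext _ (recursive_mkseq (g := g) hP _)) => [s sn|[|j]] //.
  by rewrite /h /mkseq /= (iotaDl 1 0) -map_comp -/(mkseq _ _) -sn mkseq_nth.
exact: recursive_nth.
Qed.

Lemma recursive_skip n f : recursive n.+1 f ->
  recursive n.+2 (fun s => f (head 0 s :: drop 2 s)).
Proof.
move=> fP; pose g i s := nth 0 s (if i is j.+1 then j.+2 else 0).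
apply: (recursive_ext _ (recursive_mkseq (g := g) fP _)).
  case=> [|x [|y s]] //= [sn]; congr f.
  by rewrite /mkseq /= (iotaDl 1 0) -map_comp -/(mkseq _ _) drop0 -sn mkseq_nth.
by move=> i; exact: recursive_nth.
Qed.

Lemma recursive_iter n a (k : seq nat -> nat) f :
    recursive n a -> recursive n k -> recursive n.+1 f ->
  recursive n (fun s => iter (k s) (fun r => f (r :: s)) (a s)).
Proof.
move=> aP kP fP.
have {}fP : recursive n.+2 (fun s => f (behead s)).
  apply: (recursive_ext _
    (recursive_mkseq (g := fun i s => nth 0 s i.+1) fP _)) => [|i].
    by case=> //= x s [sn]; rewrite -sn mkseq_nth.
  exact: recursive_nth.
apply: recursive_ext _ (recursive_rec aP kP fP) => s _.
by elim: (k s) => //= i ->.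
Qed.

(** Defines a function by its specification, which is how quotients and the
    decoding of sequences are obtained below. *)
Lemma recursive_min n f (P : pred (seq nat)) :
    recursive n.+1 (fun s => ~~ P s) ->
    (forall s, size s = n -> P (f s :: s)) ->
    (forall s z, size s = n -> P (z :: s) -> f s <= z) ->
  recursive n f.
Proof.
move=> [A AP] Pf minf; exists (Rmin A) => s /=; split=> [|z zf].
  by have := AP (cons_tuple (f s) s); rewrite /= Pf ?size_tuple.
exists 0; have := AP (cons_tuple z s); rewrite /=.
case: (boolP (P _)) => // /(minf _ _ (size_tuple s)); lia.
Qed.

Lemma recursive_add n a b : recursive n a -> recursive n b ->
  recursive n (fun s => a s + b s).
Proof.
move=> aP bP; apply: recursive_ext _
  (recursive_iter bP aP (recursive_succ (recursive_nth _ 0))) => s _ /=.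
by elim: (a s) => //= c ->.
Qed.

Lemma recursive_pred n a : recursive n a -> recursive n (fun s => (a s).-1).
Proof.
move=> aP; apply: recursive_ext _
  (recursive_rec (recursive_const n 0) aP (recursive_nth _ 0)) => s _ /=.
by case: (a s).
Qed.

Lemma recursive_sub n a b : recursive n a -> recursive n b ->
  recursive n (fun s => a s - b s).
Proof.
move=> aP bP; apply: recursive_ext _
  (recursive_iter aP bP (recursive_pred (recursive_nth _ 0))) => s _ /=.
by elim: (b s) => [|c /= ->]; [rewrite subn0|rewrite subnS].
Qed.

Lemma recursive_mul n a b : recursive n a -> recursive n b ->
  recursive n (fun s => a s * b s).
Proof.
move=> aP bP; have bP' : recursive n.+1 (fun s => b (behead s)).
  apply: (recursive_ext _
    (recursive_mkseq (g := fun i s => nth 0 s i.+1) bP _)) => [|i].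
    by case=> //= x s [sn]; rewrite -sn mkseq_nth.
  exact: recursive_nth.
apply: recursive_ext _ (recursive_iter (recursive_const n 0) aP
  (recursive_add bP' (recursive_nth _ 0))) => s _ /=.
by elim: (a s) => //= c ->; rewrite mulSn.
Qed.

Lemma recursive_exp n (c : nat) a : recursive n a ->
  recursive n (fun s => c ^ a s).
Proof.
move=> aP; apply: recursive_ext _ (recursive_iter (recursive_const n 1) aP
  (recursive_mul (recursive_const _ c) (recursive_nth _ 0))) => s _ /=.
by elim: (a s) => //= k ->; rewrite expnS.
Qed.

Lemma recursive_double n a : recursive n a -> recursive n (fun s => (a s).*2).
Proof.
move=> aP; apply: recursive_ext _ (recursive_add aP aP) => s _.
by rewrite addnn.
Qed.

Lemma recursive_leq n a b : recursive n a -> recursive n b ->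
  recursive n (fun s => a s <= b s).
Proof.
move=> aP bP; apply: recursive_ext _
  (recursive_sub (recursive_const n 1) (recursive_sub aP bP)) => s _.
by case: leqP; lia.
Qed.

Implicit Types P Q : pred (seq nat).

Lemma recursive_not n P : recursive n P -> recursive n (fun s => ~~ P s).
Proof.
move=> PP; apply: recursive_ext _ (recursive_sub (recursive_const n 1) PP).
by move=> s _; case: (P s).
Qed.

Lemma recursive_and n P Q : recursive n P -> recursive n Q ->
  recursive n (fun s => P s && Q s).
Proof.
move=> PP QP; apply: recursive_ext _ (recursive_mul PP QP) => s _.
by rewrite mulnb.
Qed.

Lemma recursive_or n P Q : recursive n P -> recursive n Q ->
  recursive n (fun s => P s || Q s).
Proof.
move=> /recursive_not PP /recursive_not QP.
apply: recursive_ext _ (recursive_not (recursive_and PP QP)) => s _.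
by rewrite negb_and !negbK.
Qed.

Lemma recursive_eq n a b : recursive n a -> recursive n b ->
  recursive n (fun s => a s == b s).
Proof.
move=> aP bP; apply: recursive_ext _
  (recursive_and (recursive_leq aP bP) (recursive_leq bP aP)) => s _.
by rewrite eqn_leq.
Qed.

Lemma recursive_if n P a b :
    recursive n P -> recursive n a -> recursive n b ->
  recursive n (fun s => if P s then a s else b s).
Proof.
move=> PP aP bP; apply: recursive_ext _ (recursive_add
  (recursive_mul PP aP) (recursive_mul (recursive_not PP) bP)) => s _.
by case: (P s) => /=; lia.
Qed.

Lemma recursive_has n (k : seq nat -> nat) P :
    recursive n k -> recursive n.+1 P ->
  recursive n (fun s => has (fun x => P (x :: s)) (iota 0 (k s))).
Proof.
move=> kP PP; have rP : recursive n.+2 (fun s => 0 < nth 0 s 1) :=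
  recursive_leq (recursive_const _ 1) (recursive_nth _ 1).
apply: recursive_ext _ (recursive_rec (recursive_const n 0) kP
  (recursive_or rP (recursive_skip PP))) => s _ /=.
elim: (k s) => // j IHj.
rewrite [LHS]/= IHj -[j.+1]addn1 iotaD has_cat add0n /= orbF drop0.
by case: has.
Qed.

Lemma recursive_all n (k : seq nat -> nat) P :
    recursive n k -> recursive n.+1 P ->
  recursive n (fun s => all (fun x => P (x :: s)) (iota 0 (k s))).
Proof.
move=> kP /recursive_not PP.
apply: recursive_ext _ (recursive_not (recursive_has kP PP)) => s _.
by rewrite -all_predC; congr nat_of_bool; apply: eq_all => x /=; rewrite negbK.
Qed.

End RecursiveFunctions.

(** The dispatch is on the syntax of the goal: unification up to conversion with
    a law for sums or products would unfold bounded quantifiers without end. *)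
Ltac recursive := repeat lazymatch goal with
  | |- recursive _ (fun=> ?c) => exact: recursive_const
  | |- recursive _ (fun s => nth 0 s _) => exact: recursive_nth
  | |- recursive _ (fun s => S _) => apply: recursive_succ
  | |- recursive _ (fun s => _ + _) => apply: recursive_add
  | |- recursive _ (fun s => _ - _) => apply: recursive_sub
  | |- recursive _ (fun s => _ * _) => apply: recursive_mul
  | |- recursive _ (fun s => _ ^ _) => apply: recursive_exp
  | |- recursive _ (fun s => _.*2) => apply: recursive_double
  | |- recursive _ (fun s => nat_of_bool (_ <= _)) => apply: recursive_leq
  | |- recursive _ (fun s => nat_of_bool (_ == _)) => apply: recursive_eq
  | |- recursive _ (fun s => nat_of_bool (~~ _)) => apply: recursive_not
  | |- recursive _ (fun s => nat_of_bool (_ && _)) => apply: recursive_and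
  | |- recursive _ (fun s => nat_of_bool (_ || _)) => apply: recursive_or
  | |- recursive _ (fun s => if _ then _ else _) => apply: recursive_if
  | |- _ => assumption
  end.

Section FiniteChanges.

(** Finitely many values can be tabulated. *)
Lemma recursive_patch (F G : nat -> nat) K :
    recursive 1 (fun s => F (nth 0 s 0)) -> (forall x, K <= x -> G x = F x) ->
  recursive 1 (fun s => G (nth 0 s 0)).
Proof.
move=> FP; elim: K G => [|K IHK] G GF.
  by apply: recursive_ext _ FP => s _; rewrite GF.
apply: (@recursive_ext 1
  (fun s => if nth 0 s 0 == K then G K
            else (fun x => if x == K then F K else G x) (nth 0 s 0))).
  by move=> s _; case: eqP => [->|].
apply: recursive_if; [by recursive|by recursive|].
apply: (IHK (fun x => if x == K then F K else G x)) => x Kx.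
by case: eqP => [->//|xK]; apply: GF; lia.
Qed.

Lemma recursive_modn n d a : 0 < d -> recursive n a ->
  recursive n (fun s => a s %% d).
Proof.
move=> d0; apply: (@recursive_app1 (modn^~ d)).
have divP : recursive 1 (fun s => nth 0 s 0 %/ d).
  apply: (@recursive_min _ _ (fun s => nth 0 s 1 < (nth 0 s 0).+1 * d)).
  - by recursive.
  - by move=> s _ /=; rewrite -ltn_divLR.
  - by move=> s z _ /=; rewrite -ltn_divLR // ltnS.
apply: (@recursive_ext 1 (fun s => nth 0 s 0 - nth 0 s 0 %/ d * d)).
  by move=> s _; rewrite {1}(divn_eq (nth 0 s 0) d) addKn.
by recursive.
Qed.

End FiniteChanges.

Section SequenceCodes.
Implicit Types (c k : nat) (s : seq nat).

Definition code_head c := head 0 (CodeSeq.decode c).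
Definition code_tail c := CodeSeq.code (behead (CodeSeq.decode c)).

Lemma code_pair c : 0 < c -> c = 2 ^ code_head c * (code_tail c).*2.+1.
Proof.
move=> c0; rewrite {1}(esym (CodeSeq.decodeK c)) /code_head /code_tail.
by move: c0; rewrite -{1}(CodeSeq.decodeK c); case: CodeSeq.decode.
Qed.

(** Codes of nonempty sequences are the numbers 2^k (2 b + 1), with k the head
    and b the code of the tail. *)
Lemma code_pair_uniq c k b : c = 2 ^ k * b.*2.+1 ->
  code_head c = k /\ code_tail c = b.
Proof.
rewrite -{1}(CodeSeq.decodeK b) => cE.
have {cE}-> : c = CodeSeq.code (k :: CodeSeq.decode b) by [].
by rewrite /code_head /code_tail CodeSeq.codeK /= CodeSeq.decodeK.
Qed.

Lemma code_pair_bounds c : 0 < c -> code_head c < c.+1 /\ code_tail c < c.+1.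
Proof.
move=> /code_pair cE; rewrite !ltnS; split.
  rewrite {2}cE; apply: leq_trans (ltnW (ltn_expl _ (ltnSn 1))) _.
  exact: leq_pmulr.
rewrite {2}cE; apply: leq_trans (leq_pmull _ (expn_gt0 2 _ : 0 < 2 ^ _)); lia.
Qed.

Lemma recursive_code_head n a : recursive n a ->
  recursive n (fun s => code_head (a s)).
Proof.
apply: (@recursive_app1 code_head).
pose split u := nth 0 u 2 == 2 ^ nth 0 u 1 * (nth 0 u 0).*2.+1.
apply: (@recursive_min _ _ (fun s => (nth 0 s 1 == 0) ||
  has (fun b => split (b :: s)) (iota 0 (nth 0 s 1).+1))).
- by recursive; apply: recursive_has; rewrite /split; recursive.
- move=> s _; have [_ //|c0] := posnP (nth 0 s 0).
  apply/hasP; exists (code_tail (nth 0 s 0)).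
    by rewrite mem_iota; case: (code_pair_bounds c0).
  by rewrite /split /= -code_pair.
- move=> s z _ /orP[/eqP/= ->//|/hasP[b _]].
  by move=> /eqP/code_pair_uniq[-> _].
Qed.

Lemma recursive_code_tail n a : recursive n a ->
  recursive n (fun s => code_tail (a s)).
Proof.
apply: (@recursive_app1 code_tail).
apply: (@recursive_min _ _ (fun s => (nth 0 s 1 == 0) ||
  (nth 0 s 1 == 2 ^ code_head (nth 0 s 1) * (nth 0 s 0).*2.+1))).
- by recursive; exact/recursive_code_head/recursive_nth.
- by move=> s _ /=; case: posnP => //= c0; rewrite -code_pair.
- move=> s z _ /= /orP[/eqP->//|].
  by move=> /eqP/code_pair_uniq[_ ->].
Qed.

Lemma iter_code_tail k s :
  iter k code_tail (CodeSeq.code s) = CodeSeq.code (drop k s).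
Proof.
elim: k => [|k IHk] /=; first by rewrite drop0.
by rewrite IHk /code_tail CodeSeq.codeK -drop1 drop_drop add1n.
Qed.

Lemma code_eq0 s : (CodeSeq.code s == 0) = nilp s.
Proof. by case: s => //= k s; rewrite muln_eq0 expn_eq0. Qed.

Lemma size_code s : size s <= CodeSeq.code s.
Proof.
elim: s => //= k s IHs.
apply: leq_trans (leq_pmull _ (expn_gt0 2 k : 0 < 2 ^ k)).
lia.
Qed.

Lemma recursive_iter_tail n a (k : seq nat -> nat) :
    recursive n a -> recursive n k ->
  recursive n (fun s => iter (k s) code_tail (a s)).
Proof.
move=> aP kP.
exact: (recursive_iter aP kP (recursive_code_tail (recursive_nth _ 0))).
Qed.

Lemma code_head_drop k s : code_head (CodeSeq.code (drop k s)) = nth 0 s k.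
Proof. by rewrite /code_head CodeSeq.codeK -nth0 nth_drop addn0. Qed.

(** The j-th entry is the head of the j-th iterated tail.  The recursion runs
    for as many steps as the value of the code, which is at least the number of
    entries; the steps past the end do nothing. *)
Lemma recursive_foldl n (F : nat -> nat -> nat) (c a : seq nat -> nat) :
    recursive 2 (fun s => F (nth 0 s 0) (nth 0 s 1)) ->
    recursive n c -> recursive n a ->
  recursive n (fun s => foldl F (a s) (CodeSeq.decode (c s))).
Proof.
move=> FP cP aP.
apply: (@recursive_app2 (fun c a => foldl F a (CodeSeq.decode c))) cP aP.
pose tl u := iter (nth 0 u 0) code_tail (nth 0 u 2).
have tlP : recursive 4 tl by apply: recursive_iter_tail; recursive.
pose step u :=
  if tl u == 0 then nth 0 u 1 else F (nth 0 u 1) (code_head (tl u)).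
have stepP : recursive 4 step.
  apply: recursive_if; recursive.
  by apply: recursive_app2 => //; recursive; exact: recursive_code_head.
apply: recursive_ext _
  (recursive_rec (recursive_nth 2 1) (recursive_nth 2 0) stepP).
move=> s _; set w := CodeSeq.decode _; set b := nth 0 s 1.
have cE : nth 0 s 0 = CodeSeq.code w by rewrite CodeSeq.decodeK.
rewrite -{1}(take_oversize (size_code w)) -cE.
elim: (nth 0 s 0) => /= [|j IHj]; first by rewrite take0.
rewrite {1}/step /tl /= cE iter_code_tail code_eq0 /nilp size_drop IHj subn_eq0.
case: leqP => [wj|jw]; first by rewrite !take_oversize //; lia.
by rewrite code_head_drop (take_nth 0 jw) foldl_rcons.
Qed.

Lemma recursive_all_lt n (c : seq nat -> nat) K : recursive n c ->
  recursive n (fun s => all (ltn^~ K) (CodeSeq.decode (c s))).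
Proof.
apply: (@recursive_app1 (fun c => all (ltn^~ K) (CodeSeq.decode c))).
pose entry_lt u := (iter (nth 0 u 0) code_tail (nth 0 u 1) == 0) ||
  (code_head (iter (nth 0 u 0) code_tail (nth 0 u 1)) < K).
apply: (@recursive_ext 1 (fun s =>
  all (fun j => entry_lt (j :: s)) (iota 0 (nth 0 s 0)))); last first.
  apply: recursive_all; rewrite /entry_lt; recursive;
    try apply: recursive_code_head; by apply: recursive_iter_tail; recursive.
move=> s _; rewrite /entry_lt /=; congr nat_of_bool; set w := CodeSeq.decode _.
have cE : nth 0 s 0 = CodeSeq.code w by rewrite CodeSeq.decodeK.
rewrite cE; apply/allP/(all_nthP 0) => [wP j jw|wP j _].
  have := wP j; rewrite mem_iota iter_code_tail code_eq0 /nilp size_drop.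
  rewrite subn_eq0 [size w <= j]leqNgt jw code_head_drop; apply.
  by rewrite /= add0n; apply: leq_trans jw (size_code _).
rewrite iter_code_tail code_eq0 /nilp size_drop subn_eq0 code_head_drop.
by case: (leqP (size w) j) => //= jw; exact: wP.
Qed.

Lemma code_lt K s : all (ltn^~ K) s -> CodeSeq.code s < 2 ^ (K * size s).
Proof.
elim: s => [|k s IHs] /=; first by rewrite muln0.
move=> /andP[kK /IHs cs]; rewrite [K * _]mulnS expnD.
have kE : 2 ^ k.+1 <= 2 ^ K by rewrite leq_exp2l.
apply: leq_trans (leq_mul kE cs); rewrite expnS.
have : 0 < 2 ^ k by rewrite expn_gt0.
by move: (2 ^ k) (CodeSeq.code s) => x y; nia.
Qed.

End SequenceCodes.

(** * The algorithms *)

Section Algorithm.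
Variables (n : nat) (hn : 2 <= n).
Implicit Types (p : points n) (g h x : sym (points n)) (q c : nat).

Notation S := (houghton_gens hn).
Implicit Types (u v w : word S) (l : letter S).

(** Coding along the layers of constant height turns the translation of ray i by
    t i into the addition of n t i on a residue class modulo n. *)
Definition point_code p := p.2 * n + p.1.
Definition code_point q : points n := (Ordinal (ltn_pmod q (ltnW hn)), q %/ n).

Lemma point_codeK : cancel point_code code_point.
Proof.
case=> i m; rewrite /code_point /point_code; congr pair.
  by apply: val_inj; rewrite /= modnMDl modn_small.
by rewrite divnMDl ?divn_small ?addn0 // (ltnW hn).
Qed.

Lemma code_pointK : cancel code_point point_code.
Proof. by move=> q; rewrite /point_code /= -divn_eq. Qed.

(** Above height K the action adds to q an amount that depends only on q modulo
    n, here increased by n K to be a natural number; below, it is a finite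
    table. *)
Lemma recursive_action K t g : tame K t g ->
  recursive 1 (fun s => point_code (g (code_point (nth 0 s 0)))).
Proof.
move=> [tK gE]; have n0 : 0 < n := ltnW hn.
pose T r := oapp (fun i : 'I_n => n * absz (K%:Z + t i)%R) 0 (insub r).
have TP : recursive 1 (fun s => T (nth 0 s 0)).
  apply: (@recursive_patch (fun=> 0) T n) => [|r nr]; first by recursive.
  by rewrite /T insubN // -leqNgt.
apply: (@recursive_patch (fun q => q + T (q %% n) - n * K)
  (fun q => point_code (g (code_point q))) (n * K)) => [|q Kq].
  recursive; apply: (recursive_app1 TP).
  by apply: recursive_modn => //; recursive.
have Km : K <= q %/ n by rewrite leq_divRL // mulnC.
have [-> _] := gE (code_point q).1 (q %/ n) Km.
rewrite /T insubT ?ltn_pmod //= /point_code /= => lt_qn.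
have -> : Sub (q %% n) lt_qn = (code_point q).1 by apply: val_inj.
have := tK (code_point q).1; move: (t _) => a aK.
rewrite [in RHS](divn_eq q n); move: (q %/ n) (q %% n) Km => m r Km.
have : absz (m%:Z + a)%R + K = m + absz (K%:Z + a)%R by lia.
move: (absz _) (absz _) => b c /(congr1 (muln n)).
by rewrite !mulnDr [c * n]mulnC [m * n]mulnC; lia.
Qed.

Lemma letter_code_inj : injective (@letter_code _ S).
Proof.
move=> [i b] [j d]; rewrite /letter_code /= => E.
have [bd ij] : b = d /\ i = j :> nat by case: b E; case: d => /= E; split; lia.
by rewrite bd (val_inj ij).
Qed.

Lemma letters_tame :
  exists C, forall l, exists t, tame C t (hperm (letter_val l)).
Proof.
have /choice[K KP] l : exists K, exists t, tame K t (hperm (letter_val l)).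
  exact: houghton_tame (valP (letter_val l)).
exists (\max_(l : 'I_(size S) * bool) K l) => l; have [t lT] := KP l.
by exists t; apply: tameW lT; exact: (leq_bigmax (F := K)).
Qed.

Lemma word_tame C : (forall l, exists t, tame C t (hperm (letter_val l))) ->
  forall w, exists t, tame (C * size w) t (hperm (word_val w)).
Proof.
move=> CP; elim=> [|l w [t wT]].
  by exists (fun=> 0%R); rewrite /word_val big_nil; exact: tame1.
have [s lT] := CP l; exists (fun i => s i + t i)%R.
by rewrite word_val_cons mulnS; exact: tameM lT wT.
Qed.

(** A definition by cases over the finitely many letters. *)
Lemma letter_action : exists2 F : nat -> nat -> nat,
  recursive 2 (fun s => F (nth 0 s 0) (nth 0 s 1)) &
  forall l p, F (point_code p) (letter_code l) =
              point_code (hperm (letter_val l) p).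
Proof.
suff [F FP FE] : exists2 F : nat -> nat -> nat,
    recursive 2 (fun s => F (nth 0 s 0) (nth 0 s 1)) &
    forall l, l \in enum {: 'I_(size S) * bool} -> forall p,
      F (point_code p) (letter_code l) = point_code (hperm (letter_val l) p).
  by exists F => // l p; apply: FE; rewrite mem_enum.
elim: (enum _) => [|l ls [F FP FE]].
  by exists (fun _ _ => 0) => //; recursive.
pose act q := point_code (hperm (letter_val l) (code_point q)).
exists (fun q k => if k == letter_code l then act q else F q k) => [|l' l'P p].
  recursive; apply: (@recursive_app1 act); last by recursive.
  have [K [t lT]] := houghton_tame (valP (letter_val l)).
  exact: recursive_action lT.
rewrite (inj_eq letter_code_inj); case: eqP => [->|/eqP l'l].
  by rewrite /act point_codeK.
by apply: FE; move: l'P; rewrite inE (negPf l'l).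
Qed.

Lemma foldl_word (F : nat -> nat -> nat) :
    (forall l p, F (point_code p) (letter_code l) =
                 point_code (hperm (letter_val l) p)) ->
  forall w p, foldl F (point_code p) (CodeSeq.decode (word_code w)) =
              point_code (hperm (word_val w) p).
Proof.
move=> FE w; rewrite /word_code CodeSeq.codeK.
elim: w => [|l w IHw] p; first by rewrite /word_val big_nil.
by rewrite word_val_cons /= FE IHw.
Qed.

Definition is_word c := all (ltn^~ (size S).*2) (CodeSeq.decode c).

Lemma is_wordP c : is_word c -> exists w, c = word_code w.
Proof.
rewrite /is_word -{2}(CodeSeq.decodeK c); elim: CodeSeq.decode => [|k s IHs] /=.
  by exists [::].
case/andP=> kS /IHs[w wE]; have k2 : k./2 < size S by lia.
exists ((Ordinal k2, odd k) :: w); rewrite wE /word_code /= /letter_code /=.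
by rewrite addnC odd_double_half.
Qed.

Lemma word_is_word w : is_word (word_code w).
Proof.
rewrite /is_word /word_code CodeSeq.codeK; apply/allP => k /mapP[[i b] _ ->].
rewrite /letter_code /=; move: (ltn_ord i); move: (nat_of_ord i) => j.
by move: (size _) => d jd; case: b; lia.
Qed.

Lemma size_word_code w : size w <= word_code w.
Proof. by have := size_code (map (@letter_code _ S) w); rewrite size_map. Qed.

Lemma word_code_lt k w : size w <= k -> word_code w < 2 ^ ((size S).*2 * k).
Proof.
move=> wk; have := word_is_word w; rewrite /is_word CodeSeq.codeK.
move=> /code_lt lt; apply: leq_trans lt _; rewrite size_map leq_exp2l //.
by rewrite leq_mul2l wk orbT.
Qed.

(** The common value at height K forces the drifts to agree, hence the values
    everywhere above. *)
Lemma tame_eq K t s g h : tame K t g -> tame K s h ->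
  (forall p, p.2 <= K -> g p = h p) -> g = h.
Proof.
move=> [tK gE] [sK hE] gh; apply: symP => -[i m].
have [mK|Km] := leqP m K; first exact: gh.
have := gh (i, K) (leqnn _).
have [-> _] := gE i K (leqnn _); have [-> _] := hE i K (leqnn _).
have [-> _] := gE i m (ltnW Km); have [-> _] := hE i m (ltnW Km).
by have := tK i; have := sK i => si ti [E]; congr pair; lia.
Qed.

Lemma conj_eq u v w :
  (word_val u ^ word_val w)%g = word_val v <->
  (hperm (word_val u) * hperm (word_val w) =
   hperm (word_val w) * hperm (word_val v))%g.
Proof.
split=> [<-|E].
  exact: (congr1 (@hperm n) (conjgC _ _)).
have {}E : (word_val u * word_val w = word_val w * word_val v)%g.
  exact: val_inj.
by rewrite conjgE E mulKg.
Qed.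

(** Whether u w = w v holds is checked on the points up to the height from which
    both sides are translations.  Code values serve as crude bounds for the lengths
    of words.  The first component matters for the search, whose output has to
    be the code of a word. *)
Lemma conjugator_test : exists2 P : pred (seq nat), recursive 3 P &
  (forall c s, P (c :: s) -> exists w, c = word_code w) /\
  forall u v w, P [:: word_code w; word_code u; word_code v] <->
                (word_val u ^ word_val w)%g = word_val v.
Proof.
have [F FP FE] := letter_action; have [C /word_tame CP] := letters_tame.
pose ev q c := foldl F q (CodeSeq.decode c).
pose same s := ev (ev (nth 0 s 0) (nth 0 s 2)) (nth 0 s 1) ==
               ev (ev (nth 0 s 0) (nth 0 s 1)) (nth 0 s 3).
pose bd (s : seq nat) := (C * (nth 0 s 0 + nth 0 s 1 + nth 0 s 2)).+1 * n.
exists (fun s => is_word (nth 0 s 0) &&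
                 all (fun q => same (q :: s)) (iota 0 (bd s))).
  recursive; first exact: recursive_all_lt (recursive_nth _ _).
  apply: recursive_all; rewrite /bd /same; recursive;
    do 2![apply: recursive_foldl => //; recursive].
split=> [c s /andP[/is_wordP]//|u v w]; rewrite word_is_word conj_eq /=.
have evE w' p : ev (point_code p) (word_code w') =
    point_code (hperm (word_val w') p) by exact: foldl_word.
have sameE p : same [:: point_code p; word_code w; word_code u; word_code v] =
    (hperm (word_val w) (hperm (word_val u) p) ==
     hperm (word_val v) (hperm (word_val w) p)).
  by rewrite /same /= !evE (inj_eq (can_inj point_codeK)).
split=> [/allP allP|E]; last first.
  apply/allP => q _; rewrite -[q]code_pointK sameE; apply/eqP.
  exact: (congr1 (fun f : sym _ => f (code_point q)) E).
have [t uT] := CP u; have [s vT] := CP v; have [r wT] := CP w.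
set K := C * (word_code w + word_code u + word_code v).
have [su [sv sw]] := (size_word_code u, (size_word_code v, size_word_code w)).
apply: (@tame_eq K).
- apply: tameW (tameM uT wT); rewrite -mulnDr leq_mul2l.
  by apply/orP; right; lia.
- apply: tameW (tameM wT vT); rewrite -mulnDr leq_mul2l.
  by apply/orP; right; lia.
- move=> p pK; apply/eqP; rewrite !symM -sameE; apply: allP.
  rewrite mem_iota /= /bd /= -/K add0n /point_code mulSn.
  have := ltn_ord p.1; have : p.2 * n <= K * n by rewrite leq_mul2r pK orbT.
  by lia.
Qed.

(** The shifts of g x and x h are t + s and s + t'. *)
Lemma conj_same_drift K M t t' s g h x :
    tame K t g -> tame K t' h -> tame M s x -> (g * x = x * h)%g -> t = t'.
Proof.
move=> gT hT xT E; apply/funext => i; have := tameM xT hT; rewrite -E => xhT.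
by have := congr1 (fun f => f i) (tame_uniq (tameM gT xT) xhT); lia.
Qed.

Definition conjugator_length K :=
  spelling_length n (conj_bound n K) (n * conj_bound n K).

(** The given conjugator x forces the drifts of both elements to agree; it is
    then replaced by a controlled one, which has a short spelling. *)
Lemma short_conjugator K t t' u v :
    tame K t (hperm (word_val u)) -> tame K t' (hperm (word_val v)) ->
    conjugate (word_val u) (word_val v) ->
  exists2 w : word S, size w <= conjugator_length K &
    (word_val u ^ word_val w)%g = word_val v.
Proof.
move=> uT vT [x xE]; have [M [s xT]] := houghton_tame (valP x).
have E : (hperm (word_val u) * hperm x = hperm x * hperm (word_val v))%g.
  by rewrite -xE; exact: (congr1 (@hperm n) (conjgC _ _)).
have tt' := conj_same_drift uT vT xT E; subst t'.
have [|r [y [yT yE]]] := bounded_conjugator uT vT xT.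
  by move=> p; exact: (congr1 (fun f : sym _ => f p) E).
have [z [w wL wz] zy] := spelled_tame hn yT; subst z y.
by exists w => //; apply/conj_eq; apply: symP => p; rewrite !symM yE.
Qed.

Lemma recursive_conjugator_length m a : recursive m a ->
  recursive m (fun s => conjugator_length (a s)).
Proof.
apply: (@recursive_app1 conjugator_length).
have bP : recursive 1 (fun s => conj_bound n (nth 0 s 0)).
  by rewrite /conj_bound /realign_bound /link_bound /phase_bound; recursive.
apply: (@recursive_app1 (fun b => spelling_length n b (n * b))) bP.
by rewrite /spelling_length /swap_length; recursive.
Qed.

End Algorithm.

(** Both algorithms run the test of [conjugator_test]: below a recursive bound
    on the code of the conjugator for the decision, and without a bound, by
    minimisation, for the search. *)
Theorem theorem1p2 (n : nat) (hn : 2 <= n) :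
  conjugacy_problem_solvable (houghton_gens hn) /\
  conjugator_search_solvable (houghton_gens hn).
Proof.
have [P PR [Pword PE]] := conjugator_test hn.
have [C /word_tame CP] := letters_tame hn.
have test (u v : word (houghton_gens hn)) :
    conjugate (word_val u) (word_val v) ->
    exists2 w : word (houghton_gens hn),
      size w <= conjugator_length n (C * (word_code u + word_code v)) &
      P [:: word_code w; word_code u; word_code v].
  move=> uv; have [t uT] := CP u; have [s vT] := CP v.
  have [su sv] := (size_word_code u, size_word_code v).
  have [||w wL /PE Pw] := @short_conjugator n hn
    (C * (word_code u + word_code v)) t s u v _ _ uv; last by exists w.
  - by apply: tameW uT; rewrite leq_mul2l; apply/orP; right; lia.
  - by apply: tameW vT; rewrite leq_mul2l; apply/orP; right; lia.
split.
  pose bound s := 2 ^ ((size (houghton_gens hn)).*2 *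
    conjugator_length n (C * (nth 0 s 0 + nth 0 s 1))).
  have boundP : recursive 2 bound.
    by rewrite /bound; recursive; apply: recursive_conjugator_length; recursive.
  have [A AP] := recursive_has boundP PR.
  exists A => u v; eexists; split; first exact: AP.
  split=> [/hasP[c _ Pc]|/test[w wL Pw]].
    have [w cE] := Pword _ _ Pc; subst c.
    by exists (word_val w); apply/PE.
  apply/hasP; exists (word_code w) => //; rewrite mem_iota add0n /=.
  exact: word_code_lt.
have [A AP] := recursive_not PR.
exists (Rmin A) => u v /test[w0 _ Pw0].
have ex : exists c, P [:: c; word_code u; word_code v] by exists (word_code w0).
case: (ex_minnP ex) => c Pc cmin; have [w cE] := Pword _ _ Pc; subst c.
exists w; split; last by apply/PE.
split=> [|z zw].
  by have := AP [tuple word_code w; word_code u; word_code v]; rewrite /= Pc.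
exists 0; have := AP [tuple z; word_code u; word_code v]; rewrite /=.
case: (boolP (P _)) => [/cmin|//]; by rewrite leqNgt zw.
Qed.
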